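(* Let $\mathbb{F}$ be a field of characteristic 0. In degree 7, there exist multilinear polynomial identities for the pre-Jordan triple products $\langle a,b,c\rangle_1=(a\cdot b)\cdot c$ and $\langle a,b,c\rangle_2=a\cdot(b\cdot c)$, where $a\cdot b=a\succ b+b\prec a$, in the free dendriform dialgebra over $\mathbb{F}$, which do not follow from the identities of lower degree. That is, there is an element of $\ker\mathcal{E}_7\subseteq\mathrm{TT}_7$ which does not lie in the $S_7$-submodule of $\mathrm{TT}_7$ generated by all liftings to degree 7 of elements of $\ker\mathcal{E}_5$.
   Context: A dendriform dialgebra over $\mathbb{F}$ is a vector space with two bilinear operations $\prec,\succ$ satisfying, for all $x,y,z$: $(x\succ y)\prec z = x\succ(y\prec z)$; $(x\prec y)\prec z = x\prec(y\prec z)+x\prec(y\succ z)$; $x\succ(y\succ z)=(x\succ y)\succ z+(x\prec y)\succ z$. $\mathrm{DD}_n$ denotes the multilinear subspace of degree $n$ of the free dendriform dialgebra on $x_1,\dots,x_n$ over $\mathbb{F}$. $\mathrm{TT}_n$ ($n$ odd) denotes the multilinear subspace of degree $n$ of the free (nonassociative) algebra on $x_1,\dots,x_n$ with two trilinear operations $\langle x,y,z\rangle_1,\langle x,y,z\rangle_2$ and no relations. $S_n$ acts on both by permuting the variables, $\sigma\cdot x_i=x_{\sigma(i)}$. The expansion map $\mathcal{E}_n\colon\mathrm{TT}_n\to\mathrm{DD}_n$ is the linear map that replaces each occurrence of $\langle x,y,z\rangle_1$ by $(x\cdot y)\cdot z$ and each occurrence of $\langle x,y,z\rangle_2$ by $x\cdot(y\cdot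 z)$, where $x\cdot y=x\succ y+y\prec x$ is the pre-Jordan product. Its kernel is the space of multilinear identities of degree $n$ satisfied by the pre-Jordan triple products. Liftings: for $f=f(x_1,\dots,x_n)\in\mathrm{TT}_n$, its $2(n+3)$ liftings to $\mathrm{TT}_{n+2}$ are, for $i=1,2$: the $n$ substitutions $f(x_1,\dots,\langle x_k,x_{n+1},x_{n+2}\rangle_i,\dots,x_n)$ for $k=1,\dots,n$, and the three products $\langle f,x_{n+1},x_{n+2}\rangle_i$, $\langle x_{n+1},f,x_{n+2}\rangle_i$, $\langle x_{n+1},x_{n+2},f\rangle_i$. The liftings generate the $S_{n+2}$-module of consequences of $f$ in degree $n+2$. (Liftings to degree 5 of degree 3 identities already lie in $\ker\mathcal{E}_5$.) *)

(* Defs.v *)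
From HB Require Import structures.
From mathcomp Require Import all_boot all_order all_algebra perm.
From mathcomp Require Import boolp finmap monalg.

Set Implicit Arguments.
Unset Strict Implicit.
Unset Printing Implicit Defensive.

Import GRing.Theory.
Local Open Scope ring_scope.
Local Open Scope quotient_scope.

HB.lock Definition lext (F : fieldType) (K : choiceType) (V : lmodType F)
    (h : K -> V) (f : {malg F[K]}) : V :=
  \sum_(k <- msupp f) f@_k *: h k.

Section LinearExtension.
Variables (F : fieldType) (K : choiceType) (V : lmodType F) (h : K -> V).

Lemma lextEw (d : {fset K}) (f : {malg F[K]}) : (msupp f `<=` d)%fset ->
  lext h f = \sum_(k <- d) f@_k *: h k.
Proof.
move=> le; rewrite lext.unlock (big_fset_incl _ le) // => k _.
by rewrite -mcoeff_eq0 => /eqP ->; rewrite scale0r.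
Qed.

Lemma lext_is_linear : linear (lext h).
Proof.
move=> a f g.
pose d := (msupp f `|` msupp g `|` msupp (a *: f + g))%fset.
rewrite (@lextEw d); last by rewrite /d fsubsetUr.
rewrite (@lextEw d f); last by rewrite /d -fsetUA fsubsetUl.
rewrite (@lextEw d g); last by rewrite /d fsetUAC fsubsetUr.
rewrite scaler_sumr -big_split /=; apply: eq_bigr => k _.
by rewrite mcoeffD mcoeffZ scalerDl scalerA.
Qed.

HB.instance Definition _ :=
  GRing.isLinear.Build F {malg F[K]} V *:%R (lext h) lext_is_linear.

Lemma lextU k : lext h << k >> = h k.
Proof.
by rewrite lext.unlock msuppU oner_eq0 big_seq_fset1 mcoeffUU scale1r.
Qed.

Lemma lext_fun_linear (h' : K -> V) (a : F) f :
  lext (fun k => a *: h k + h' k) f = a *: lext h f + lext h' f.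
Proof.
rewrite lext.unlock scaler_sumr -big_split /=; apply: eq_bigr => k _.
by rewrite scalerDr !scalerA mulrC.
Qed.

Lemma eq_lext (h' : K -> V) : h =1 h' -> lext h =1 lext h'.
Proof.
by move=> e f; rewrite lext.unlock; apply: eq_bigr => k _; rewrite e.
Qed.

End LinearExtension.

Lemma msupp_lext (F : fieldType) (K K' : choiceType) (h : K -> {malg F[K']})
    (P : pred K') (f : {malg F[K]}) :
  (forall k, k \in msupp f -> all P (msupp (h k))) -> all P (msupp (lext h f)).
Proof.
rewrite lext.unlock big_seq => H.
elim/big_rec: _ => [|k g /H/allP Hk /allP Hg]; first by rewrite msupp0.
apply/allP => k' /(fsubsetP (msuppD_le _ _)); rewrite in_fsetU => /orP[|/Hg //].
by move/(fsubsetP (msuppZ_le _ _))/Hk.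
Qed.

Lemma all_msuppU (F : fieldType) (K : choiceType) (P : pred K) (k : K) :
  P k -> all P (msupp (<< k >> : {malg F[K]})).
Proof.
by move=> Pk; apply/allP => k'; rewrite msuppU oner_eq0 in_fset1 => /eqP ->.
Qed.

Lemma malg_sumE (F : fieldType) (K : choiceType) (f : {malg F[K]}) :
  f = \sum_(k <- msupp f) f@_k *: (<< k >> : {malg F[K]}).
Proof.
rewrite {1}[f]monalgE; apply: eq_bigr => k _; apply/malgP => k'.
by rewrite mcoeffZ !mcoeffU mulrnAr mulr1.
Qed.

Lemma lext_uniq (F : fieldType) (K : choiceType) (V : lmodType F)
    (u v : {linear {malg F[K]} -> V}) :
  (forall k, u << k >> = v << k >>) -> u =1 v.
Proof.
move=> uv f; rewrite [f]malg_sumE !linear_sum /=.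
by apply: eq_bigr => k _; rewrite !linearZ /= uv.
Qed.

(* The index [false] of [BNode] stands for the operation prec and [true] for  *)
(* succ; the index [false] of [TNode] stands for <x,y,z>_1, [true] for        *)
(* <x,y,z>_2.                                                                 *)
Inductive btree (X : Type) := BLeaf of X | BNode of bool & btree X & btree X.
Inductive ttree (X : Type) :=
  TLeaf of X | TNode of bool & ttree X & ttree X & ttree X.

Fixpoint bleaves X (t : btree X) : seq X :=
  match t with BLeaf x => [:: x] | BNode _ t u => bleaves t ++ bleaves u end.
Fixpoint tleaves X (t : ttree X) : seq X :=
  match t with
  | TLeaf x => [:: x]
  | TNode _ t u v => tleaves t ++ tleaves u ++ tleaves v
  end.

Fixpoint btree_encode X (t : btree X) : GenTree.tree X :=
  match t with
  | BLeaf x => GenTree.Leaf x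
  | BNode b t u => GenTree.Node (nat_of_bool b) [:: btree_encode t; btree_encode u]
  end.
Fixpoint btree_decode X (t : GenTree.tree X) : option (btree X) :=
  match t with
  | GenTree.Leaf x => Some (BLeaf x)
  | GenTree.Node b [:: t; u] =>
      if btree_decode t is Some t' then
        if btree_decode u is Some u' then Some (BNode (b == 1%N) t' u') else None
      else None
  | _ => None
  end.
Lemma btree_encodeK X : pcancel (@btree_encode X) (@btree_decode X).
Proof. by elim=> //= b t -> u ->; case: b. Qed.
HB.instance Definition _ (X : choiceType) :=
  Choice.copy (btree X) (pcan_type (@btree_encodeK X)).

Fixpoint ttree_encode X (t : ttree X) : GenTree.tree X :=
  match t with
  | TLeaf x => GenTree.Leaf x
  | TNode b t u v => GenTree.Node (nat_of_bool b)
      [:: ttree_encode t; ttree_encode u; ttree_encode v]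
  end.
Fixpoint ttree_decode X (t : GenTree.tree X) : option (ttree X) :=
  match t with
  | GenTree.Leaf x => Some (TLeaf x)
  | GenTree.Node b [:: t; u; v] =>
      if ttree_decode t is Some t' then
        if ttree_decode u is Some u' then
          if ttree_decode v is Some v' then Some (TNode (b == 1%N) t' u' v')
          else None
        else None
      else None
  | _ => None
  end.
Lemma ttree_encodeK X : pcancel (@ttree_encode X) (@ttree_decode X).
Proof. by elim=> //= b t -> u -> v ->; case: b. Qed.
HB.instance Definition _ (X : choiceType) :=
  Choice.copy (ttree X) (pcan_type (@ttree_encodeK X)).

Section Dendriform.
Variables (F : fieldType) (A : lmodType F) (prec succ : A -> A -> A).
Local Infix "≺" := prec (at level 45, no associativity).
Local Infix "≻" := succ (at level 45, no associativity).

Definition bilinear_op (op : A -> A -> A) : Prop :=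
  (forall y, linear (op^~ y)) /\ (forall x, linear (op x)).

Definition dend_defect1 (x y z : A) : A :=
  ((x ≻ y) ≺ z) - (x ≻ (y ≺ z)).
Definition dend_defect2 (x y z : A) : A :=
  ((x ≺ y) ≺ z) - ((x ≺ (y ≺ z)) + (x ≺ (y ≻ z))).
Definition dend_defect3 (x y z : A) : A :=
  (x ≻ (y ≻ z)) - (((x ≻ y) ≻ z) + ((x ≺ y) ≻ z)).

Record is_dendriform : Prop := IsDendriform {
  prec_bilinear : bilinear_op prec;
  succ_bilinear : bilinear_op succ;
  dendriform1 : forall x y z, (x ≻ y) ≺ z = x ≻ (y ≺ z);
  dendriform2 : forall x y z, (x ≺ y) ≺ z = (x ≺ (y ≺ z)) + (x ≺ (y ≻ z));
  dendriform3 : forall x y z, x ≻ (y ≻ z) = ((x ≻ y) ≻ z) + ((x ≺ y) ≻ z)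
}.

Definition prejordan (x y : A) : A := (x ≻ y) + (y ≺ x).

Definition prejordan_triple (i : bool) (x y z : A) : A :=
  if i then prejordan x (prejordan y z) else prejordan (prejordan x y) z.

End Dendriform.

(* The free dendriform dialgebra on X: the free nonassociative algebra with   *)
(* two binary operations, modulo the ideal generated by all values of the     *)
(* defining relations.                                                        *)
HB.lock Definition bmul (F : fieldType) (X : choiceType) (s : bool)
    (f g : {malg F[btree X]}) : {malg F[btree X]} :=
  lext (fun t => lext (fun u => << BNode s t u >>) g) f.

Section FreeDendriform.
Variables (F : fieldType) (X : choiceType).
Local Notation Mag := {malg F[btree X]}.
Local Notation bmul := (@bmul F X).

Lemma bmul_bilinear s : bilinear_op (bmul s).
Proof.
split=> [g|f] a u v; first by rewrite bmul.unlock linearP.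
rewrite bmul.unlock.
apply/esym/(etrans (esym (lext_fun_linear _ _ _ _)))/eq_lext => t.
exact/esym/lext_is_linear.
Qed.

Lemma bmulUU s t u : bmul s << t >> << u >> = << BNode s t u >>.
Proof. by rewrite bmul.unlock !lextU. Qed.

Inductive dend_ideal : Mag -> Prop :=
| DI_rel1 x y z : dend_ideal (dend_defect1 (bmul false) (bmul true) x y z)
| DI_rel2 x y z : dend_ideal (dend_defect2 (bmul false) (bmul true) x y z)
| DI_rel3 x y z : dend_ideal (dend_defect3 (bmul false) (bmul true) x y z)
| DI_0 : dend_ideal 0
| DI_lin (a : F) f g : dend_ideal f -> dend_ideal g -> dend_ideal (a *: f + g)
| DI_mull s f g : dend_ideal g -> dend_ideal (bmul s f g)
| DI_mulr s f g : dend_ideal f -> dend_ideal (bmul s f g).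

Definition dend_pred : Mag -> bool := fun f => `[< dend_ideal f >].

Lemma dend_predE f : (f \in dend_pred) = `[< dend_ideal f >].
Proof. by []. Qed.

Lemma dend_pred_closed : zmod_closed dend_pred.
Proof.
split=> [|f g]; rewrite !dend_predE; first by apply/asboolP/DI_0.
move=> /asboolP If /asboolP Ig; apply/asboolP.
by rewrite addrC -scaleN1r; apply: DI_lin.
Qed.
HB.instance Definition _ := GRing.isZmodClosed.Build Mag dend_pred dend_pred_closed.

Definition dend_closed : zmodClosed Mag := GRing.ZmodClosed.clone Mag dend_pred _.

Definition DD : Type := Quotient.quot dend_closed.
HB.instance Definition _ := GRing.Zmodule.on DD.
HB.instance Definition _ := EqQuotient.on DD.

End FreeDendriform.

HB.lock Definition dproj (F : fieldType) (X : choiceType)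
  (f : {malg F[btree X]}) : DD F X := \pi_(DD F X) f.

Section FreeDendriformOps.
Variables (F : fieldType) (X : choiceType).
Local Notation Mag := {malg F[btree X]}.
Local Notation DD := (DD F X).
Local Notation dend_ideal := (@dend_ideal F X).
Local Notation dproj := (@dproj F X).
Local Notation bmul := (@bmul F X).
Local Notation dend_closed := (@dend_closed F X).

Lemma dproj_is_zmod_morphism : zmod_morphism dproj.
Proof. by move=> f g; rewrite dproj.unlock; exact: (raddfB (\pi_(Quotient.quot dend_closed))). Qed.

Lemma dproj_eq f g : (dproj f = dproj g) <-> dend_ideal (f - g).
Proof.
rewrite dproj.unlock; split => [/eqP|I].
  by rewrite piE Quotient.equivE => /asboolP.
by apply/eqP; rewrite piE Quotient.equivE; apply/asboolP.
Qed.

Lemma dprojP (x : DD) : exists f, x = dproj f.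
Proof. by exists (repr x); rewrite dproj.unlock reprK. Qed.

Lemma reprP f : dend_ideal (repr (dproj f) - f).
Proof. by apply/dproj_eq; rewrite dproj.unlock reprK. Qed.

Lemma dprojD f g : dproj (f + g) = dproj f + dproj g.
Proof. by rewrite dproj.unlock; exact: (raddfD (\pi_(Quotient.quot dend_closed))). Qed.

Lemma DI_scale (a : F) f : dend_ideal f -> dend_ideal (a *: f).
Proof. by move=> If; rewrite -[a *: f]addr0; apply: DI_lin => //; apply: DI_0. Qed.
Lemma DI_add f g : dend_ideal f -> dend_ideal g -> dend_ideal (f + g).
Proof. by move=> If Ig; rewrite -[f]scale1r; apply: DI_lin. Qed.

Definition dscale (a : F) (x : DD) : DD := dproj (a *: repr x).

Lemma dprojZ a f : dscale a (dproj f) = dproj (a *: f).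
Proof. by apply/dproj_eq; rewrite -scalerBr; apply/DI_scale/reprP. Qed.

Lemma dscaleA a b x : dscale a (dscale b x) = dscale (a * b) x.
Proof. by have [f ->] := dprojP x; rewrite !dprojZ scalerA. Qed.
Lemma dscale1 : left_id 1 dscale.
Proof. by move=> x; have [f ->] := dprojP x; rewrite !dprojZ scale1r. Qed.
Lemma dscaleDr : right_distributive dscale +%R.
Proof.
move=> a x y; have [f ->] := dprojP x; have [g ->] := dprojP y.
by rewrite -dprojD !dprojZ -dprojD scalerDr.
Qed.
Lemma dscaleDl x : {morph dscale^~ x : a b / a + b}.
Proof.
by move=> a b; have [f ->] := dprojP x; rewrite !dprojZ -dprojD scalerDl.
Qed.
HB.instance Definition _ :=
  GRing.Zmodule_isLmodule.Build F DD dscaleA dscale1 dscaleDr dscaleDl.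

Lemma dproj_is_linear : linear dproj.
Proof. by move=> a f g; rewrite dprojD -dprojZ. Qed.
HB.instance Definition _ := GRing.isLinear.Build F Mag DD *:%R dproj dproj_is_linear.

Lemma dprojL a f g : a *: dproj f + dproj g = dproj (a *: f + g).
Proof. exact/esym/dproj_is_linear. Qed.

Definition dmul (s : bool) (x y : DD) : DD := dproj (bmul s (repr x) (repr y)).
Definition dprec := dmul false.
Definition dsucc := dmul true.
Definition dvar (x : X) : DD := dproj << BLeaf x >>.

Lemma bmulBl s f g h : bmul s (f - g) h = bmul s f h - bmul s g h.
Proof.
have [L _] := bmul_bilinear F X s.
by rewrite -scaleN1r addrC L scaleN1r addrC.
Qed.
Lemma bmulBr s f g h : bmul s f (g - h) = bmul s f g - bmul s f h.
Proof.
have [_ L] := bmul_bilinear F X s.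
by rewrite -scaleN1r addrC L scaleN1r addrC.
Qed.

Lemma dprojM s f g : dproj (bmul s f g) = dmul s (dproj f) (dproj g).
Proof.
apply/esym/dproj_eq; set g' := repr (dproj g); set f' := repr (dproj f).
have D1 : dend_ideal (bmul s f' g' - bmul s f g').
  by rewrite -(bmulBl s f' f g'); exact/DI_mulr/reprP.
have D2 : dend_ideal (bmul s f g' - bmul s f g).
  by rewrite -(bmulBr s f g' g); exact/DI_mull/reprP.
by have := DI_add D1 D2; rewrite (subrKA (bmul s f g')).
Qed.

Lemma DD_is_dendriform : is_dendriform dprec dsucc.
Proof.
have bil s : bilinear_op (dmul s).
  have [L R] := bmul_bilinear F X s; split=> x a u v.
    have [f ->] := dprojP x; have [g ->] := dprojP u; have [h ->] := dprojP v.
    apply: etrans (congr1 (dmul s ^~ (dproj f)) (dprojL a g h)) _.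
    apply: etrans (esym (dprojM s (a *: g + h) f)) _.
    apply: etrans (congr1 dproj (L f a g h)) _.
    apply: etrans (esym (dprojL a (bmul s g f) (bmul s h f))) _.
    exact: (congr2 +%R (congr1 ( *:%R a) (dprojM s g f)) (dprojM s h f)).
  have [f ->] := dprojP x; have [g ->] := dprojP u; have [h ->] := dprojP v.
  apply: etrans (congr1 (dmul s (dproj f)) (dprojL a g h)) _.
  apply: etrans (esym (dprojM s f (a *: g + h))) _.
  apply: etrans (congr1 dproj (R f a g h)) _.
  apply: etrans (esym (dprojL a (bmul s f g) (bmul s f h))) _.
  exact: (congr2 +%R (congr1 ( *:%R a) (dprojM s f g)) (dprojM s f h)).
split; [exact: bil | exact: bil | | | ] => x y z.
all: have [f ->] := dprojP x; have [g ->] := dprojP y; have [h ->] := dprojP z.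
all: rewrite /dprec /dsucc -!dprojM.
- exact/dproj_eq/DI_rel1.
- by rewrite -dprojD; exact/dproj_eq/DI_rel2.
- by rewrite -dprojD; exact/dproj_eq/DI_rel3.
Qed.

(* The elements that are homogeneous of multidegree [s]. *)
Definition multihomog (s : seq X) (d : DD) : Prop :=
  exists2 f : Mag, d = dproj f & all (fun t => perm_eq (bleaves t) s) (msupp f).

Lemma multihomog0 s : multihomog s 0.
Proof.
exists 0; last by rewrite msupp0.
by apply: (addrI (dproj 0)); rewrite -dprojD !addr0.
Qed.

Lemma multihomogL s a d e :
  multihomog s d -> multihomog s e -> multihomog s (a *: d + e).
Proof.
move=> [f -> /allP Hf] [g -> /allP Hg]; exists (a *: f + g); first exact: dprojL.
apply/allP => t /(fsubsetP (msuppD_le _ _)); rewrite in_fsetU => /orP[|/Hg //].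
by move/(fsubsetP (msuppZ_le _ _))/Hf.
Qed.

Lemma multihomog_perm s s' d : perm_eq s s' -> multihomog s d -> multihomog s' d.
Proof.
move=> ss' [f -> /allP Hf]; exists f => //.
by apply/allP => t /Hf /perm_trans; apply.
Qed.

Lemma multihomogM b s s' d e :
  multihomog s d -> multihomog s' e -> multihomog (s ++ s') (dmul b d e).
Proof.
move=> [f -> /allP Hf] [g -> /allP Hg]; exists (bmul b f g); first exact/esym/dprojM.
rewrite bmul.unlock; apply: msupp_lext => t /Hf Ht; apply: msupp_lext => u /Hg Hu.
by apply: all_msuppU; apply: perm_cat.
Qed.

End FreeDendriformOps.

Section FreeDendriformUniversal.
Variables (F : fieldType) (X : choiceType) (A : lmodType F).
Variables (prec succ : A -> A -> A) (dendA : is_dendriform prec succ).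
Variable a : X -> A.

Let op (s : bool) := if s then succ else prec.
Fixpoint beval (t : btree X) : A :=
  match t with BLeaf x => a x | BNode s t u => op s (beval t) (beval u) end.

Lemma lext_bmul s f g :
  lext beval (bmul s f g) = op s (lext beval f) (lext beval g).
Proof.
have [L R] : bilinear_op (op s) by rewrite /op; case: s; case: dendA.
have [L' R'] := bmul_bilinear F X s.
pose Ul h := HB.pack_for {linear {malg F[btree X]} -> A}
  (fun f => lext beval (bmul s f h))
  (GRing.isLinear.Build F _ A *:%R _ (fun c u v =>
     etrans (congr1 (lext beval) (L' h c u v)) (linearP (lext beval) c _ _))).
pose Ur h := HB.pack_for {linear {malg F[btree X]} -> A}
  (fun f => lext beval (bmul s h f))
  (GRing.isLinear.Build F _ A *:%R _ (fun c u v =>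
     etrans (congr1 (lext beval) (R' h c u v)) (linearP (lext beval) c _ _))).
pose Vl y := HB.pack_for {linear {malg F[btree X]} -> A}
  (fun f => op s (lext beval f) y)
  (GRing.isLinear.Build F _ A *:%R _ (fun c u v =>
     etrans (congr1 (op s ^~ y) (linearP (lext beval) c u v)) (L y c _ _))).
pose Vr y := HB.pack_for {linear {malg F[btree X]} -> A}
  (fun f => op s y (lext beval f))
  (GRing.isLinear.Build F _ A *:%R _ (fun c u v =>
     etrans (congr1 (op s y) (linearP (lext beval) c u v)) (R y c _ _))).
apply: (@lext_uniq _ _ _ (Ul g) (Vl (lext beval g))) => t /=.
apply: (@lext_uniq _ _ _ (Ur << t >>) (Vr (lext beval << t >>))) => u /=.
by rewrite bmulUU !lextU.
Qed.

Lemma lext_dend_ideal f : dend_ideal f -> lext beval f = 0.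
Proof.
have [[PL PR] [SL SR] D1 D2 D3] := dendA.
have op0l s x : op s 0 x = 0.
  have [L _] : bilinear_op (op s) by rewrite /op; case: s.
  by have := L x (-1) 0 0; rewrite scaler0 addr0 scaleN1r addNr.
have op0r s x : op s x 0 = 0.
  have [_ R] : bilinear_op (op s) by rewrite /op; case: s.
  by have := R x (-1) 0 0; rewrite scaler0 addr0 scaleN1r addNr.
elim=> {f} [x y z|x y z|x y z||c f g _ If _ Ig|s f g _ Ig|s f g _ If].
- by rewrite /dend_defect1 (linearB (lext beval)) /= !lext_bmul /= D1 subrr.
- rewrite /dend_defect2 (linearB (lext beval)) (linearD (lext beval)) /=.
  rewrite (lext_bmul false (bmul false x y) z).
  rewrite (lext_bmul false x (bmul false y z)).
  rewrite (lext_bmul false x (bmul true y z)).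
  rewrite (lext_bmul false x y) (lext_bmul false y z) (lext_bmul true y z).
  by rewrite /op D2 subrr.
- rewrite /dend_defect3 (linearB (lext beval)) (linearD (lext beval)) /=.
  rewrite (lext_bmul true (bmul true x y) z).
  rewrite (lext_bmul true (bmul false x y) z).
  rewrite (lext_bmul true x (bmul true y z)).
  rewrite (lext_bmul true x y) (lext_bmul true y z) (lext_bmul false x y).
  by rewrite /op D3 subrr.
- by rewrite linear0.
- by rewrite linearP /= If Ig scaler0 addr0.
- by rewrite lext_bmul Ig op0r.
- by rewrite lext_bmul If op0l.
Qed.

Lemma DD_universal :
  exists phi : DD F X -> A,
    [/\ linear phi,
        forall x, phi (dvar F x) = a x,
        forall x y, phi (dprec x y) = prec (phi x) (phi y),
        forall x y, phi (dsucc x y) = succ (phi x) (phi y)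
      & forall psi : {linear DD F X -> A},
          (forall x, psi (dvar F x) = a x) ->
          (forall x y, psi (dprec x y) = prec (psi x) (psi y)) ->
          (forall x y, psi (dsucc x y) = succ (psi x) (psi y)) ->
          psi =1 phi].
Proof.
pose phi (d : DD F X) := lext beval (repr d).
have phiE f : phi (dproj f) = lext beval f.
  apply/eqP; rewrite /phi -subr_eq0 -linearB /=; apply/eqP.
  exact/lext_dend_ideal/reprP.
have phiM s x y : phi (dmul s x y) = op s (phi x) (phi y).
  have [f ->] := dprojP x; have [g ->] := dprojP y.
  by rewrite -dprojM !phiE lext_bmul.
exists phi; split.
- move=> c x y; have [f ->] := dprojP x; have [g ->] := dprojP y.
  by rewrite (dprojL c f g) !phiE linearP.
- by move=> x; rewrite phiE lextU.
- exact: (phiM false).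
- exact: (phiM true).
move=> psi psiX psiP psiS d; have [f ->] := dprojP d; rewrite phiE.
pose psi' : {linear {malg F[btree X]} -> A} := psi \o @dproj F X.
apply: (@lext_uniq _ _ _ psi' (lext beval)) => t.
rewrite [RHS]lextU /=; elim: t => [x|s t IHt u IHu]; first exact: psiX.
rewrite -bmulUU dprojM /= -IHt -IHu; case: s; [apply: psiS | apply: psiP].
Qed.

End FreeDendriformUniversal.

(* The free nonassociative algebra on X with two trilinear operations is      *)
(* {malg F[ttree X]}, with the operations tmul false and tmul true.           *)
HB.lock Definition tmul (F : fieldType) (X : choiceType) (i : bool)
    (f g h : {malg F[ttree X]}) : {malg F[ttree X]} :=
  lext (fun t => lext (fun u => lext (fun v => << TNode i t u v >>) h) g) f.

Section FreeTernary.
Variables (F : fieldType).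

Section Mul.
Variable X : choiceType.

Lemma tmulUUU i t u v :
  tmul i << t >> << u >> << v >> = << TNode i t u v >> :> {malg F[ttree X]}.
Proof. by rewrite tmul.unlock !lextU. Qed.

Definition tvar (x : X) : {malg F[ttree X]} := << TLeaf x >>.

End Mul.

Section Eval.
Variables (X : choiceType) (A : lmodType F) (op : bool -> A -> A -> A -> A).
Variable a : X -> A.

Fixpoint teval_tree (t : ttree X) : A :=
  match t with
  | TLeaf x => a x
  | TNode i t u v => op i (teval_tree t) (teval_tree u) (teval_tree v)
  end.

(* When [op] is trilinear, the homomorphism extending [a]. *)
Definition teval (f : {malg F[ttree X]}) : A := lext teval_tree f.

End Eval.

Definition tsubst (X Y : choiceType) (a : X -> {malg F[ttree Y]})
    (f : {malg F[ttree X]}) : {malg F[ttree Y]} :=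
  teval (@tmul F Y) a f.

Section Multilinear.
Variable n : nat.

Definition TT : {pred {malg F[ttree 'I_n]}} :=
  fun f => all (fun t => perm_eq (tleaves t) (enum 'I_n)) (msupp f).

Definition multilinear_DD : DD F 'I_n -> Prop := multihomog (enum 'I_n).

Definition tperm_act (s : 'S_n) : {malg F[ttree 'I_n]} -> {malg F[ttree 'I_n]} :=
  tsubst (fun i => tvar (s i)).

Definition expansion : {malg F[ttree 'I_n]} -> DD F 'I_n :=
  teval (prejordan_triple (@dprec F 'I_n) (@dsucc F 'I_n)) (@dvar F 'I_n).

Lemma expansion_multilinear f : f \in TT -> multilinear_DD (expansion f).
Proof.
move=> /allP Hf; rewrite /expansion /teval lext.unlock big_seq.
elim/big_rec: _ => [|t d /Hf Ht Hd]; first exact: multihomog0.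
apply: multihomogL Hd; apply: multihomog_perm Ht _ => {d}.
have mulJ s s' d e : multihomog s d -> multihomog s' e ->
    multihomog (s ++ s') (prejordan (@dprec F 'I_n) (@dsucc F 'I_n) d e).
  move=> Hd He; rewrite /prejordan -[X in X + _]scale1r.
  apply: multihomogL; first exact: multihomogM.
  apply: (multihomog_perm _ (multihomogM false He Hd)).
  by rewrite perm_catC perm_refl.
elim: t => [x|i t IHt u IHu v IHv] /=.
  by exists << BLeaf x >> => //; apply: all_msuppU.
case: i => /=; first exact: (mulJ _ _ _ _ IHt (mulJ _ _ _ _ IHu IHv)).
by rewrite catA; exact: (mulJ _ _ _ _ (mulJ _ _ _ _ IHt IHu) IHv).
Qed.

Definition ker_expansion (f : {malg F[ttree 'I_n]}) : Prop :=
  f \in TT /\ expansion f = 0.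

Inductive Sn_module (G : {malg F[ttree 'I_n]} -> Prop) :
    {malg F[ttree 'I_n]} -> Prop :=
| Sn_gen f : G f -> Sn_module G f
| Sn_0 : Sn_module G 0
| Sn_lin (a : F) f g : Sn_module G f -> Sn_module G g -> Sn_module G (a *: f + g)
| Sn_act s f : Sn_module G f -> Sn_module G (tperm_act s f).

End Multilinear.

(* [lshift 2 j] is x_j among the variables of degree n + 2. *)
Definition liftings (n : nat) (f : {malg F[ttree 'I_n]}) :
    seq {malg F[ttree 'I_(n + 2)]} :=
  let x j := tvar (lshift 2 j) in
  let y := tvar (rshift n (ord0 : 'I_2)) in
  let z := tvar (rshift n (ord_max : 'I_2)) in
  let f' := tsubst x f in
  [seq tsubst (fun j => if j == k then tmul i (x k) y z else x j) f
    | i <- [:: false; true], k <- enum 'I_n]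
  ++ flatten [seq [:: tmul i f' y z; tmul i y f' z; tmul i y z f']
    | i <- [:: false; true]].

Lemma size_liftings n f : size (@liftings n f) = (2 * (n + 3))%N.
Proof. by rewrite size_cat size_allpairs size_enum_ord /= mulnDr. Qed.

Definition lifted_identities (n : nat) : {malg F[ttree 'I_(n + 2)]} -> Prop :=
  Sn_module (fun g => exists2 f, @ker_expansion n f & g \in liftings f).

End FreeTernary.

(* Main.v *)
Require Import Defs.
From HB Require Import structures.
From mathcomp Require Import all_boot all_order all_algebra.
From mathcomp Require Import finmap monalg.
From mathcomp Require Import perm fingroup zify.

Import GRing.Theory.
Local Open Scope ring_scope.

(* The new identity is alternating in six variables and linear in a seventh   *)
(* one; it is a sum of 24 monomials, each alternated over the six variables.  *)
(* It is non-trivial modulo consequences because of the functional that adds  *)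
(* up, with the sign of the word of variables, the coefficients of the        *)
(* monomials <.,.,<.,.,<p,q,.>_1>_1>_1 in which the seventh variable is p or  *)
(* q. A lifting of f in ker E_5 contributes to it only through the monomials  *)
(* <.,.,<.,.,.>_1>_1 of f, with a variable singled out in the last position   *)
(* (when the innermost triple is substituted) or in one of the positions 3    *)
(* and 4 (when f is the last factor of a product). Both signed sums of        *)
(* coefficients are linear functions of E_5 f: they can be read off the       *)
(* normal form of E_5 f in the basis of the free dendriform dialgebra given   *)
(* by planar binary trees, hence they vanish.                                 *)

Set Implicit Arguments.
Unset Strict Implicit.
Unset Printing Implicit Defensive.

(** In every dendriform dialgebra, products of trees (l > x) < r rewrite into sums of such trees
    ([peval_ops]), hence so does every expanded monomial ([peval_expansion]). Conversely, planar
    trees themselves form a dendriform dialgebra ([planar_dendriform]), so the universal property of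
    [DD] turns the vanishing of an expansion into the vanishing of a formal sum of planar trees
    ([ker_expansion_planar]).

    Alternation makes these sums small. Each term of an expansion carries the parity of the
    permutation of variables that produced it ([parity_expansion]). Once all variables but one are
    alternated, a monomial or normal form matters, up to sign, only through its shape and the place
    of the remaining variable: a tree with Boolean leaves.

    What remains is finite computation. Two tables in degree 5 give functionals vanishing on ker E_5
    ([ker_expansion_functional]), whence [sign_functional] vanishes on all consequences
    ([sign_functional_lifted]). The marked normal forms of the 24 monomials cancel
    ([expansion_new_identity]). Exactly one of these monomials is seen by [sign_functional], whose
    value on the identity is therefore 6! ([sign_functional_new_identity]). Characteristic 0 makes
    6! and the scale 8 of the tables nonzero. *)

(** * Linear maps on free modules *)

Section LinearMaps.
Variables (F : fieldType) (K : choiceType) (V : lmodType F).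

Lemma linear_lext_ext (u v : {malg F[K]} -> V) : linear u -> linear v ->
  (forall k, u << k >> = v << k >>) -> u =1 v.
Proof.
move=> lu lv.
pose u' := HB.pack_for {linear {malg F[K]} -> V} u (GRing.isLinear.Build F _ V *:%R u lu).
pose v' := HB.pack_for {linear {malg F[K]} -> V} v (GRing.isLinear.Build F _ V *:%R v lv).
exact: (@lext_uniq F K V u' v').
Qed.

End LinearMaps.

Section LinearExtensionTheory.
Variables (F : fieldType) (K : choiceType) (V : lmodType F).

Lemma lext_comp (W : lmodType F) (L : V -> W) (h : K -> V) f : linear L ->
  L (lext h f) = lext (L \o h) f.
Proof.
move=> lL; move: f; apply: linear_lext_ext => [a f g|a f g|k].
- by rewrite linearP lL.
- by rewrite linearP.
- by rewrite !lextU.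
Qed.

Lemma lextE (h : K -> V) f : lext h f = \sum_(k <- msupp f) f@_k *: h k.
Proof. by rewrite lext.unlock. Qed.

Lemma lext0 (h : K -> V) f : {in msupp f, forall k, h k = 0} -> lext h f = 0.
Proof.
by move=> h0; rewrite lextE big1_seq // => k /andP[_ /h0 ->]; rewrite scaler0.
Qed.

Lemma eq_lext_supp (h h' : K -> V) f : {in msupp f, h =1 h'} -> lext h f = lext h' f.
Proof. by move=> hh'; rewrite !lextE; apply: eq_big_seq => k /hh' ->. Qed.

End LinearExtensionTheory.

(** * The dendriform dialgebra of planar binary trees *)

(* The normal form in the free dendriform dialgebra: PNode l x r stands for   *)
(* (l > x) < r, where an empty side is omitted. The empty tree is not an      *)
(* element of the dialgebra, it only makes the recursion uniform.             *)
Inductive ptree (Y : Type) := PNil | PNode of ptree Y & Y & ptree Y.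
Arguments PNil {Y}.

Section PlanarTrees.
Variable Y : Type.
Implicit Types t u v : ptree Y.

Fixpoint ptree_encode t : GenTree.tree Y :=
  if t is PNode l x r
  then GenTree.Node 0 [:: ptree_encode l; GenTree.Leaf x; ptree_encode r]
  else GenTree.Node 0 [::].
Fixpoint ptree_decode (t : GenTree.tree Y) : option (ptree Y) :=
  match t with
  | GenTree.Node _ [:: l; GenTree.Leaf x; r] =>
      if (ptree_decode l, ptree_decode r) is (Some l', Some r')
      then Some (PNode l' x r') else None
  | _ => Some PNil
  end.
Lemma ptree_encodeK : pcancel ptree_encode ptree_decode.
Proof. by elim=> //= l -> x r ->. Qed.

Fixpoint pleaves t : seq Y :=
  if t is PNode l x r then pleaves l ++ x :: pleaves r else [::].

Definition is_pnode t := if t is PNil then false else true.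

(** The associative product t < u + t > u, with [PNil] added as unit. A recursive call shrinks
    either argument, hence the inner fixpoint. *)
Fixpoint star t u {struct t} : seq (ptree Y) :=
  match t with
  | PNil => [:: u]
  | PNode l x r =>
      (fix star_t u := match u with
       | PNil => [:: t]
       | PNode l' x' r' =>
           map (PNode l x) (star r u) ++ [seq PNode a x' r' | a <- star_t l']
       end) u
  end.

(** [PNil], a unit for [star], annihilates here, so that the dendriform relations hold on all trees
    without exception. *)
Definition pprec t u := if t is PNode l x r then
  if is_pnode u then map (PNode l x) (star r u) else [::] else [::].
Definition psucc t u := if u is PNode l x r then
  if is_pnode t then [seq PNode a x r | a <- star t l] else [::] else [::].

Lemma star0t u : star PNil u = [:: u]. Proof. by []. Qed.
Lemma start0 t : star t PNil = [:: t]. Proof. by case: t. Qed.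

Lemma star_node t u : is_pnode t -> is_pnode u ->
  star t u = pprec t u ++ psucc t u.
Proof. by case: t u => [|l x r] [|l' x' r']. Qed.

Arguments star : simpl never.

Section Sums.
Variables (V : zmodType).
Implicit Type h : ptree Y -> V.

Lemma sum_star h l x r l' x' r' :
  \sum_(v <- star (PNode l x r) (PNode l' x' r')) h v =
  \sum_(v <- star r (PNode l' x' r')) h (PNode l x v) +
  \sum_(v <- star (PNode l x r) l') h (PNode v x' r').
Proof. by rewrite star_node //= big_cat !big_map. Qed.

(* Sort the terms of both sides by the factor containing the root of the      *)
(* result; the middle factor contributes the common third part.               *)
Lemma star_assoc h t u v :
  \sum_(a <- star t u) \sum_(b <- star a v) h b =
  \sum_(a <- star u v) \sum_(b <- star t a) h b.
Proof.
elim: t u v h => [|l _ x r IHr] u v h.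
  by rewrite star0t big_seq1; apply: eq_bigr => a _; rewrite star0t big_seq1.
elim: v u h => [|l2 IHl x2 r2 _] u h.
  rewrite start0 big_seq1; apply: eq_bigr => a _; by rewrite start0 big_seq1.
case: u => [|l1 x1 r1]; first by rewrite start0 star0t !big_seq1.
set t := PNode l x r; set u := PNode l1 x1 r1; set v := PNode l2 x2 r2.
have E1 := IHr u v (fun b => h (PNode l x b)).
rewrite [RHS]sum_star in E1.
have E2 := IHl u (fun b => h (PNode b x2 r2)).
rewrite [LHS]sum_star in E2.
rewrite [LHS]sum_star [RHS]sum_star.
under eq_bigr do rewrite sum_star.
under [X in _ + X = _]eq_bigr do rewrite sum_star.
under [X in _ = X + _]eq_bigr do rewrite sum_star.
under [X in _ = _ + X]eq_bigr do rewrite sum_star.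
rewrite !big_split /= E1 -E2 (exchange_big _ _ (star t l1)) /=.
rewrite -!addrA [X in _ = _ + X]addrCA; congr (_ + (_ + _)).
by rewrite addrCA.
Qed.

End Sums.

Lemma sum_prec_prec (V : zmodType) (h : ptree Y -> V) t u v :
  \sum_(a <- pprec t u) \sum_(b <- pprec a v) h b =
  \sum_(a <- pprec u v) \sum_(b <- pprec t a) h b +
  \sum_(a <- psucc u v) \sum_(b <- pprec t a) h b.
Proof.
case: t => [|l x r].
  by rewrite big_nil !big1 ?addr0 // => a _; exact: big_nil.
case: u => [|l1 x1 r1]; first by case: v => [|? ? ?]; rewrite !big_nil addr0.
case: v => [|l2 x2 r2].
  by rewrite !big_nil addr0 big1 // => -[|? ? ?]; rewrite /= big_nil.
rewrite -big_cat -star_node // big_map /=.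
under eq_bigr do rewrite big_map.
rewrite star_assoc [LHS]sum_star [RHS]sum_star.
by congr (_ + _); apply: eq_bigr => a _; rewrite /= big_map.
Qed.

Lemma sum_succ_prec (V : zmodType) (h : ptree Y -> V) t u v :
  \sum_(a <- psucc t u) \sum_(b <- pprec a v) h b =
  \sum_(a <- pprec u v) \sum_(b <- psucc t a) h b.
Proof.
case: u => [|l1 x1 r1]; first by rewrite !big_nil.
case: t => [|l x r].
  by rewrite big_nil big1 // => -[|? ? ?]; rewrite /= big_nil.
case: v => [|l2 x2 r2].
  by rewrite big_nil big1 // => -[|? ? ?]; rewrite /= big_nil.
rewrite !big_map; under eq_bigr do rewrite /= big_map.
by rewrite exchange_big; apply: eq_bigr => a _; rewrite /= big_map.
Qed.

Lemma sum_succ_succ (V : zmodType) (h : ptree Y -> V) t u v :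
  \sum_(a <- psucc u v) \sum_(b <- psucc t a) h b =
  \sum_(a <- psucc t u) \sum_(b <- psucc a v) h b +
  \sum_(a <- pprec t u) \sum_(b <- psucc a v) h b.
Proof.
case: v => [|l2 x2 r2].
  by rewrite big_nil !big1 ?addr0 // => a _; exact: big_nil.
case: u => [|l1 x1 r1].
  by case: t => [|? ? ?]; rewrite !big_nil addr0.
case: t => [|l x r].
  by rewrite !big_nil addr0 big1 // => -[|? ? ?]; rewrite /= big_nil.
rewrite addrC -big_cat -star_node // big_map /=.
under eq_bigr do rewrite big_map.
rewrite -star_assoc [LHS]sum_star [RHS]sum_star.
by congr (_ + _); apply: eq_bigr => a _; rewrite /= big_map.
Qed.

End PlanarTrees.

HB.instance Definition _ (Y : choiceType) :=
  Choice.copy (ptree Y) (pcan_type (@ptree_encodeK Y)).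

HB.lock Definition pmul (F : fieldType) (Y : choiceType)
    (op : ptree Y -> ptree Y -> seq (ptree Y)) (f g : {malg F[ptree Y]}) :
    {malg F[ptree Y]} :=
  lext (fun t => lext (fun u => \sum_(v <- op t u) << v >>) g) f.

Section PlanarTreeAlgebra.
Variables (F : fieldType) (Y : choiceType).
Local Notation M := {malg F[ptree Y]}.
Local Notation pmul := (@pmul F Y).
Implicit Type op : ptree Y -> ptree Y -> seq (ptree Y).

Lemma pmul_bilinear op : bilinear_op (pmul op).
Proof.
split=> [g|f] a u v; rewrite pmul.unlock; first by rewrite linearP.
apply/esym/(etrans (esym (lext_fun_linear _ _ _ _)))/eq_lext => t.
exact/esym/lext_is_linear.
Qed.

Lemma pmulUU op t u : pmul op << t >> << u >> = \sum_(v <- op t u) << v >>.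
Proof. by rewrite pmul.unlock !lextU. Qed.

Lemma pmul_suml op (s : seq (ptree Y)) u :
  pmul op (\sum_(t <- s) << t >>) << u >> =
  \sum_(t <- s) \sum_(v <- op t u) << v >>.
Proof.
have [L _] := pmul_bilinear op.
elim: s => [|t s IH].
  (* Linearity at the scalar -1 and two zero vectors gives the value 0 at 0. *)
  by rewrite !big_nil; have := L << u >> (-1) 0 0; rewrite scaler0 addr0 scaleN1r addNr.
by rewrite !big_cons -IH -pmulUU -[X in X + _]scale1r L scale1r.
Qed.

Lemma pmul_sumr op (s : seq (ptree Y)) u :
  pmul op << u >> (\sum_(t <- s) << t >>) =
  \sum_(t <- s) \sum_(v <- op u t) << v >>.
Proof.
have [_ L] := pmul_bilinear op.
elim: s => [|t s IH].
  by rewrite !big_nil; have := L << u >> (-1) 0 0; rewrite scaler0 addr0 scaleN1r addNr.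
by rewrite !big_cons -IH -pmulUU -[X in X + _]scale1r L scale1r.
Qed.

Lemma pmul_trilinear_ext (S T : M -> M -> M -> M) :
  (forall y z, linear (fun x => S x y z)) ->
  (forall x z, linear (fun y => S x y z)) ->
  (forall x y, linear (fun z => S x y z)) ->
  (forall y z, linear (fun x => T x y z)) ->
  (forall x z, linear (fun y => T x y z)) ->
  (forall x y, linear (fun z => T x y z)) ->
  (forall t u v, S << t >> << u >> << v >> = T << t >> << u >> << v >>) ->
  forall x y z, S x y z = T x y z.
Proof.
move=> S1 S2 S3 T1 T2 T3 ST x y z; move: x.
apply: linear_lext_ext => // t; move: y; apply: linear_lext_ext => // u.
by move: z; apply: linear_lext_ext.
Qed.

Lemma planar_dendriform :
  is_dendriform (pmul (@pprec Y)) (pmul (@psucc Y)).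
Proof.
have [P1 P2] := pmul_bilinear (@pprec Y); have [S1 S2] := pmul_bilinear (@psucc Y).
split; [exact: pmul_bilinear | exact: pmul_bilinear | | | ].
- apply: pmul_trilinear_ext; try by move=> ? ? a f g; rewrite ?(S1, S2, P1, P2).
  by move=> t u v; rewrite !pmulUU pmul_suml pmul_sumr sum_succ_prec.
- apply: pmul_trilinear_ext; try by move=> ? ? a f g;
    rewrite ?(S1, S2, P1, P2) // scalerDr addrACA.
  by move=> t u v; rewrite !pmulUU pmul_suml !pmul_sumr sum_prec_prec.
- apply: pmul_trilinear_ext; try by move=> ? ? a f g;
    rewrite ?(S1, S2, P1, P2) // scalerDr addrACA.
  by move=> t u v; rewrite !pmulUU !pmul_suml pmul_sumr sum_succ_succ.
Qed.

End PlanarTreeAlgebra.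

(** * Signed normal forms of the triple products *)

Fixpoint ttree_map (Y Z : Type) (f : Y -> Z) (t : ttree Y) : ttree Z :=
  match t with
  | TLeaf x => TLeaf (f x)
  | TNode i t u v => TNode i (ttree_map f t) (ttree_map f u) (ttree_map f v)
  end.
Fixpoint ptree_map (Y Z : Type) (f : Y -> Z) (t : ptree Y) : ptree Z :=
  if t is PNode l x r then PNode (ptree_map f l) (f x) (ptree_map f r) else PNil.

Section SignedExpansion.
Variable Y : Type.
Implicit Types (t : ttree Y) (u v : ptree Y) (a b : seq (bool * ptree Y)).

(* The Boolean is the parity of the permutation of the variables, each one    *)
(* counted as odd: in x . y = x > y + y < x the second term swaps x and y.    *)
Definition signed_prejordan a b : seq (bool * ptree Y) :=
  flatten [seq [seq (p.1 (+) q.1, v) | v <- psucc p.2 q.2] ++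
    [seq (p.1 (+) q.1 (+) (odd (size (pleaves p.2)) && odd (size (pleaves q.2))), v)
       | v <- pprec q.2 p.2] | p <- a, q <- b].

Fixpoint signed_expansion t : seq (bool * ptree Y) :=
  match t with
  | TLeaf x => [:: (false, PNode PNil x PNil)]
  | TNode false t u v => signed_prejordan
      (signed_prejordan (signed_expansion t) (signed_expansion u)) (signed_expansion v)
  | TNode true t u v => signed_prejordan
      (signed_expansion t) (signed_prejordan (signed_expansion u) (signed_expansion v))
  end.

Lemma sum_signed_prejordan (V : zmodType) (h : bool * ptree Y -> V) a b :
  \sum_(q <- signed_prejordan a b) h q = \sum_(p <- a) \sum_(q <- b)
   (\sum_(v <- psucc p.2 q.2) h (p.1 (+) q.1, v) +
    \sum_(v <- pprec q.2 p.2)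
      h (p.1 (+) q.1 (+) (odd (size (pleaves p.2)) && odd (size (pleaves q.2))), v)).
Proof.
rewrite /signed_prejordan big_flatten big_allpairs_dep /=.
by apply: eq_bigr => p _; apply: eq_bigr => q _; rewrite big_cat !big_map.
Qed.

(** The product of two nonempty trees has only nonempty terms. *)
Lemma sum_star_pnode (V : zmodType) (f g : ptree Y -> V) u v :
  is_pnode u -> is_pnode v ->
  \sum_(w <- star u v) (if is_pnode w then f w else g w) = \sum_(w <- star u v) f w.
Proof. by case: u v => [//|l x r] [//|l' x' r'] _ _; rewrite !sum_star. Qed.

Section Evaluation.
Variables (F : fieldType) (A : lmodType F) (prec succ : A -> A -> A).
Hypothesis dendA : is_dendriform prec succ.
Variable e : Y -> A.

Fixpoint peval u : A :=
  if u is PNode l x r then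
    let m := if is_pnode l then succ (peval l) (e x) else e x in
    if is_pnode r then prec m (peval r) else m
  else 0.

Let L l x := if is_pnode l then succ (peval l) (e x) else e x.

Lemma op_suml (op : A -> A -> A) (I : Type) (s : seq I) (h : I -> A) x : bilinear_op op ->
  op (\sum_(i <- s) h i) x = \sum_(i <- s) op (h i) x.
Proof.
case=> B _; elim: s => [|i s IH].
  by rewrite !big_nil; have := B x (-1) 0 0; rewrite scaler0 addr0 scaleN1r addNr.
by rewrite !big_cons -IH -[h i]scale1r B !scale1r.
Qed.

Lemma op_sumr (op : A -> A -> A) (I : Type) (s : seq I) (h : I -> A) x : bilinear_op op ->
  op x (\sum_(i <- s) h i) = \sum_(i <- s) op x (h i).
Proof.
case=> _ B; elim: s => [|i s IH].
  by rewrite !big_nil; have := B x (-1) 0 0; rewrite scaler0 addr0 scaleN1r addNr.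
by rewrite !big_cons -IH -[h i]scale1r B !scale1r.
Qed.

(** The second relation gives (m < r) < v = m < (r < v + r > v), and the third u > (l' > x') = (u >
    l' + u < l') > x'; the first lets a right factor r' be split off. The recursion of [star] is the
    resulting induction on the right subtree of [u] and the left subtree of [v]. *)
Lemma peval_ops_pnode u v : is_pnode u -> is_pnode v ->
  prec (peval u) (peval v) = \sum_(w <- pprec u v) peval w /\
  succ (peval u) (peval v) = \sum_(w <- psucc u v) peval w.
Proof.
have [PB SB D1 D2 D3] := dendA; have [[P1 P2] [S1 S2]] := (PB, SB).
elim: u v => [//|l _ x r IHr] v _.
elim: v => [//|l' IHl x' r' _] _.
set u := PNode l x r; set v := PNode l' x' r'.
split.
- rewrite [LHS]/= [pprec u v]/= big_map -[if is_pnode l then _ else _]/(L l x).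
  rewrite -/v; under eq_bigr do rewrite /= -/(L l x).
  case: ifP => [nr|]; last by case: (r) => // _; rewrite star0t big_seq1.
  have [E1 E2] := IHr v nr isT.
  rewrite D2 E1 E2 !(op_sumr _ _ _ PB) sum_star_pnode //.
  by rewrite star_node // big_cat.
- have K : succ (peval u) (L l' x') = \sum_(w <- star u l') L w x'.
    rewrite {1}/L; case: ifP => [nl|]; last by case: (l') => // _; rewrite start0 big_seq1.
    have [E1 E2] := IHl nl; rewrite D3 E1 E2 !(op_suml _ _ _ SB) [in RHS]/L sum_star_pnode //.
    by rewrite star_node // big_cat addrC.
  rewrite [psucc u v]/= big_map -/u.
  under eq_bigr do rewrite /= -/(L _ x').
  rewrite [peval v]/= -/(L l' x').
  by case: ifP => nr; rewrite ?K // -D1 K (op_suml _ _ _ PB).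
Qed.

Lemma peval_ops u v :
  prec (peval u) (peval v) = \sum_(w <- pprec u v) peval w /\
  succ (peval u) (peval v) = \sum_(w <- psucc u v) peval w.
Proof.
have [PB SB _ _ _] := dendA.
have op0l (op : A -> A -> A) x : bilinear_op op -> op 0 x = 0.
  by move=> B; have := op_suml [::] (fun i : nat => 0) x B; rewrite !big_nil.
have op0r (op : A -> A -> A) x : bilinear_op op -> op x 0 = 0.
  by move=> B; have := op_sumr [::] (fun i : nat => 0) x B; rewrite !big_nil.
have [nu|/negbTE nu] := boolP (is_pnode u); last first.
  by case: u v nu => // -[|? ? ?] _; rewrite /= !op0l ?big_nil.
have [nv|/negbTE nv] := boolP (is_pnode v); first exact: peval_ops_pnode.
by case: v u nv {nu} => // -[|? ? ?] _; rewrite /= !op0r ?big_nil.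
Qed.

Lemma prejordan_sum a b :
  prejordan prec succ (\sum_(p <- a) peval p.2) (\sum_(q <- b) peval q.2) =
  \sum_(q <- signed_prejordan a b) peval q.2.
Proof.
have [PB SB _ _ _] := dendA.
rewrite sum_signed_prejordan /prejordan (op_suml _ _ _ SB) (op_sumr _ _ _ PB) -big_split.
apply: eq_bigr => p _ /=.
rewrite (op_sumr _ _ _ SB) (op_suml _ _ _ PB) -big_split; apply: eq_bigr => q _ /=.
by rewrite (peval_ops p.2 q.2).2 (peval_ops q.2 p.2).1.
Qed.

(** The Booleans are not coefficients: every normal form occurs with coefficient 1, and its Boolean
    only records a parity. *)
Lemma peval_expansion (C : choiceType) (g : C -> Y) (t : ttree C) :
  teval_tree (prejordan_triple prec succ) (e \o g) t =
  \sum_(q <- signed_expansion (ttree_map g t)) peval q.2.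
Proof.
elim: t => [x|[] t1 IH1 t2 IH2 t3 IH3] /=; first by rewrite big_seq1.
  by rewrite IH1 IH2 IH3 !prejordan_sum.
by rewrite IH1 IH2 IH3 !prejordan_sum.
Qed.

End Evaluation.

End SignedExpansion.

(** * Compatibility of expansions with relabelling *)

Section Naturality.
Variables (Y Z : Type) (f : Y -> Z).
Implicit Types u v : ptree Y.
Let fs (q : bool * ptree Y) := (q.1, ptree_map f q.2).

Lemma pleaves_map u : pleaves (ptree_map f u) = map f (pleaves u).
Proof. by elim: u => //= l -> x r ->; rewrite map_cat. Qed.

Lemma tleaves_map t : tleaves (ttree_map f t) = map f (tleaves t).
Proof. by elim: t => //= i t -> u -> v ->; rewrite !map_cat. Qed.

Lemma star_map u v :
  star (ptree_map f u) (ptree_map f v) = map (ptree_map f) (star u v).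
Proof.
elim: u v => [//|l _ x r IHr] v; elim: v => [//|l' IHl x' r' _].
rewrite !star_node //= !map_cat -!map_comp.
rewrite -[PNode (ptree_map f l') _ _]/(ptree_map f (PNode l' x' r')) IHr.
by move: IHl => /= ->; rewrite -!map_comp.
Qed.

Lemma pprec_map u v :
  pprec (ptree_map f u) (ptree_map f v) = map (ptree_map f) (pprec u v).
Proof.
case: u v => [|l x r] [|l' x' r'] //=.
by have /= -> := star_map r (PNode l' x' r'); rewrite -!map_comp.
Qed.

Lemma psucc_map u v :
  psucc (ptree_map f u) (ptree_map f v) = map (ptree_map f) (psucc u v).
Proof.
case: u v => [|l x r] [|l' x' r'] //=.
by have /= -> := star_map (PNode l x r) l'; rewrite -!map_comp.
Qed.

Lemma signed_prejordan_map a b :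
  signed_prejordan (map fs a) (map fs b) = map fs (signed_prejordan a b).
Proof.
rewrite /signed_prejordan map_flatten map_allpairs allpairs_mapl allpairs_mapr.
congr flatten; apply: eq_allpairs => p q.
by rewrite map_cat /= psucc_map pprec_map !pleaves_map !size_map -!map_comp.
Qed.

Lemma signed_expansion_map t :
  signed_expansion (ttree_map f t) = map fs (signed_expansion t).
Proof.
elim: t => [x|[] t1 IH1 t2 IH2 t3 IH3] //=.
  by rewrite IH1 IH2 IH3 !signed_prejordan_map.
by rewrite IH1 IH2 IH3 !signed_prejordan_map.
Qed.

End Naturality.

(** * Parity of words *)

(** Parity of the number of inversions, that is, the sign of the word as a permutation when its
    letters are distinct. *)
Fixpoint inv_parity (w : seq nat) : bool :=
  if w is x :: w' then odd (count (fun y => y < x)%N w') (+) inv_parity w' else false.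

Definition cross_parity (v w : seq nat) : bool :=
  odd (sumn [seq count (fun y => y < x)%N w | x <- v]).

Lemma inv_parity_cat v w :
  inv_parity (v ++ w) = inv_parity v (+) inv_parity w (+) cross_parity v w.
Proof.
rewrite /cross_parity; elim: v => [|x v IH] /=; first by rewrite addbF.
rewrite IH count_cat !oddD.
by case: (odd (count _ v)) (odd (count _ w)) (odd (sumn _)) (inv_parity v)
  (inv_parity w) => [] [] [] [] [].
Qed.

Lemma cross_parity_catr u v w :
  cross_parity u (v ++ w) = cross_parity u v (+) cross_parity u w.
Proof.
rewrite /cross_parity -oddD; congr odd.
by elim: u => //= x u ->; rewrite count_cat; lia.
Qed.

(** A letter of [v] and one of [w] differ, so they are inverted in exactly one of the two orders;
    there are size v * size w such pairs. *)
Lemma cross_parityC v w : uniq (v ++ w) ->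
  cross_parity v w (+) cross_parity w v = odd (size v) && odd (size w).
Proof.
rewrite cat_uniq => /and3P[_ /hasPn vw _].
rewrite /cross_parity -oddD -oddM; congr odd.
elim: v vw => [|x v IH] vw /=; first by rewrite mul0n; elim: (w).
have /IH{}IH : {in w, forall y, y \notin v}.
  by move=> y /vw; rewrite inE negb_or => /andP[].
have C : (count (fun y => y < x)%N w + count (fun y => x < y)%N w = size w)%N.
  elim: w vw {IH} => //= y w IHw vw.
  have := vw y (mem_head _ _); rewrite inE negb_or eq_sym => /andP[xy _].
  by rewrite -IHw => [|z zw]; [lia | apply: vw; rewrite inE zw orbT].
rewrite mulSn -IH -C.
suff -> : (sumn [seq ((x < y) + count (fun z => z < y) v)%N | y <- w] =
  count (fun y => x < y)%N w + sumn [seq count (fun z => z < y)%N v | y <- w])%N by lia.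
by elim: (w) => //= y w' ->; lia.
Qed.

Lemma inv_parity_swap w1 p q w2 : uniq (w1 ++ p ++ q ++ w2) ->
  inv_parity (w1 ++ q ++ p ++ w2) =
  inv_parity (w1 ++ p ++ q ++ w2) (+) (odd (size p) && odd (size q)).
Proof.
move=> Uw; have U : uniq (p ++ q).
  by move: Uw; rewrite cat_uniq => /and3P[_ _]; rewrite catA cat_uniq => /and3P[].
rewrite -(cross_parityC U) !inv_parity_cat !cross_parity_catr.
case: (cross_parity w1 p) (cross_parity w1 q) (cross_parity w1 w2)
  (cross_parity p q) (cross_parity q p) (cross_parity p w2) (cross_parity q w2)
  => [] [] [] [] [] [] [];
by case: (inv_parity w1) (inv_parity p) (inv_parity q) (inv_parity w2)
  => [] [] [] [].
Qed.

Lemma pleaves_star (Y : choiceType) (u v w : ptree Y) :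
  w \in star u v -> pleaves w = pleaves u ++ pleaves v.
Proof.
elim: u v w => [|l _ x r IHr] v w; first by rewrite star0t inE => /eqP->.
elim: v w => [|l' IHl x' r' _] w; first by rewrite start0 inE cats0 => /eqP->.
rewrite star_node // mem_cat => /orP[] /mapP[a Ha ->].
  by rewrite /= (IHr _ _ Ha) -catA.
by rewrite /= (IHl _ Ha) /= -!catA.
Qed.

Lemma pleaves_pprec (Y : choiceType) (u v w : ptree Y) :
  w \in pprec u v -> pleaves w = pleaves u ++ pleaves v.
Proof.
case: u v => [//|l x r] [//|l' x' r'] /mapP[a Ha ->].
by rewrite /= (pleaves_star Ha) -catA.
Qed.

Lemma pleaves_psucc (Y : choiceType) (u v w : ptree Y) :
  w \in psucc u v -> pleaves w = pleaves u ++ pleaves v.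
Proof.
case: u v => [|l x r] [|l' x' r'] // /mapP[a Ha ->].
by rewrite /= (pleaves_star Ha) -!catA.
Qed.

(** The context [w1], [w2] is what lets the property pass to factors of a product; later it holds
    the variables added by a lifting. *)
Definition parity_correct (w : seq nat) (q : bool * ptree nat) : Prop :=
  perm_eq (pleaves q.2) w /\ forall w1 w2, uniq (w1 ++ w ++ w2) ->
  inv_parity (w1 ++ pleaves q.2 ++ w2) = q.1 (+) inv_parity (w1 ++ w ++ w2).

Lemma parity_signed_prejordan v w a b :
  {in a, forall p, parity_correct v p} -> {in b, forall q, parity_correct w q} ->
  {in signed_prejordan a b, forall r, parity_correct (v ++ w) r}.
Proof.
move=> Ha Hb r /flattenP[s /allpairsP[[p q] /= [/Ha[pv pp] /Hb[qw qp] ->]]].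
have U w1 w2 : uniq (w1 ++ (v ++ w) ++ w2) ->
    [/\ uniq (w1 ++ pleaves p.2 ++ pleaves q.2 ++ w2),
        uniq (w1 ++ v ++ pleaves q.2 ++ w2) & uniq ((w1 ++ v) ++ w ++ w2)].
  move=> U; have E s0 : perm_eq s0 (w1 ++ (v ++ w) ++ w2) -> uniq s0 by move/perm_uniq->.
  split; apply: E; rewrite -!catA ?perm_refl // perm_cat2l !catA perm_cat2r.
    exact: perm_cat.
  by rewrite perm_cat2l.
have I w1 w2 : uniq (w1 ++ (v ++ w) ++ w2) ->
    inv_parity (w1 ++ pleaves p.2 ++ pleaves q.2 ++ w2) =
    p.1 (+) q.1 (+) inv_parity (w1 ++ (v ++ w) ++ w2).
  case/U=> _ U1 U2; rewrite pp // catA qp // -!catA.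
  by rewrite addbA.
rewrite mem_cat => /orP[] /mapP[u Hu ->]; split=> /=.
- by rewrite (pleaves_psucc Hu) perm_cat.
- by move=> w1 w2 Uw; rewrite (pleaves_psucc Hu) -(catA (pleaves _)) I.
- by rewrite (pleaves_pprec Hu) perm_catC perm_cat.
- move=> w1 w2 Uw; rewrite (pleaves_pprec Hu) -(catA (pleaves _)) inv_parity_swap.
    by rewrite I // addbAC.
  by have [] := U _ _ Uw.
Qed.

Lemma parity_expansion (t : ttree nat) :
  {in signed_expansion t, forall q, parity_correct (tleaves t) q}.
Proof.
elim: t => [x|[] t1 IH1 t2 IH2 t3 IH3] /=.
- by move=> q; rewrite inE => /eqP->.
- by do 2?apply: parity_signed_prejordan.
- by rewrite catA; do 2?apply: parity_signed_prejordan.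
Qed.

Lemma odd_size_tleaves (Y : Type) (t : ttree Y) : odd (size (tleaves t)).
Proof. by elim: t => //= i t Ht u Hu v Hv; rewrite !size_cat !oddD Ht Hu Hv. Qed.

(** * From tables of marked trees to functionals vanishing on the kernel *)

Section Functional.
Variables (F : fieldType).
Local Notation M := {malg F[ptree nat]}.

Lemma peval_planar (Y : choiceType) (u : ptree Y) : is_pnode u ->
  peval (pmul (@pprec Y)) (pmul (@psucc Y))
    (fun x => << PNode PNil x PNil >> : {malg F[ptree Y]}) u = << u >>.
Proof.
set ev := peval _ _ _; elim: u => // l IHl x r IHr _.
have El : ev (PNode l x PNil) = << PNode l x PNil >>.
  case: l IHl => // l1 x1 r1 /(_ isT) IHl.
  have -> : ev (PNode (PNode l1 x1 r1) x PNil) =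
      pmul (@psucc Y) (ev (PNode l1 x1 r1)) << PNode PNil x PNil >> by [].
  by rewrite IHl pmulUU /psucc start0 big_seq1.
case: r IHr => // l1 x1 r1 /(_ isT) IHr.
have -> : ev (PNode l x (PNode l1 x1 r1)) =
    pmul (@pprec Y) (ev (PNode l x PNil)) (ev (PNode l1 x1 r1)) by [].
by rewrite El IHr pmulUU /pprec star0t big_seq1.
Qed.

Lemma ker_expansion_planar n (f : {malg F[ttree 'I_n]}) (g : 'I_n -> nat) :
  expansion f = 0 ->
  lext (fun t => \sum_(q <- signed_expansion (ttree_map g t)) (<< q.2 >> : M)) f = 0.
Proof.
move=> Ef.
have D := planar_dendriform F nat.
have [phi [phil phiv phip phis _]] := DD_universal D (fun j => << PNode PNil (g j) PNil >>).
have phi0 : phi 0 = 0 by have := phil (-1) 0 0; rewrite scaler0 addr0 scaleN1r addNr.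
transitivity (phi (expansion f)); last by rewrite Ef.
rewrite /expansion /teval (lext_comp _ _ phil); apply: eq_lext => t /=.
pose e x : M := << PNode PNil x PNil >>.
have -> : phi (teval_tree (prejordan_triple (@dprec F 'I_n) (@dsucc F 'I_n))
    (@dvar F 'I_n) t) =
   teval_tree (prejordan_triple (pmul (@pprec nat)) (pmul (@psucc nat))) (e \o g) t.
  have phiJ x y : phi (prejordan (@dprec F 'I_n) (@dsucc F 'I_n) x y) =
      prejordan (pmul (@pprec nat)) (pmul (@psucc nat)) (phi x) (phi y).
    by rewrite /prejordan -[X in phi (X + _)]scale1r phil scale1r phip phis.
  by elim: t => //= -[] t1 <- t2 <- t3 <- /=; rewrite !phiJ.
rewrite (peval_expansion D); apply: eq_big_seq => q Hq.
have [pq _] := parity_expansion Hq.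
(* The empty tree cannot occur, since the number of leaves is odd. *)
apply/esym/peval_planar; case: (q.2) pq => // /perm_size/= E.
by have := odd_size_tleaves (ttree_map g t); rewrite -E.
Qed.

Lemma ttree_map_comp (X Y Z : Type) (a : Y -> Z) (b : X -> Y) (t : ttree X) :
  ttree_map a (ttree_map b t) = ttree_map (a \o b) t.
Proof. by elim: t => //= i t -> u -> v ->. Qed.

Lemma eq_ttree_map (X Y : Type) (a b : X -> Y) : a =1 b -> ttree_map a =1 ttree_map b.
Proof. by move=> ab; elim=> [x|i t IHt u IHu v IHv] /=; rewrite ?ab ?IHt ?IHu ?IHv. Qed.

(** Weight a normal form by the sign of its word times the table value of its marked shape. By
    [parity_expansion] the sign is that of the monomial times that of the term, so the hypothesis on
    [tab] evaluates the weighted expansion of a monomial to [N] times the summand below. *)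
Lemma ker_expansion_functional n (tab : ptree bool -> int) (C : pred (ttree bool)) (N : nat)
    (f : {malg F[ttree 'I_n]}) (g : 'I_n -> nat) (k : 'I_n) (l1 l2 : seq nat) :
  (forall m : ttree bool, size (tleaves m) = n -> count id (tleaves m) = 1%N ->
    \sum_(q <- signed_expansion m) (-1) ^+ q.1 * tab q.2 = (C m * N)%:Z) ->
  ker_expansion f -> uniq (l1 ++ map g (enum 'I_n) ++ l2) -> N%:R != 0 :> F ->
  lext (fun t : ttree 'I_n =>
    (-1) ^+ inv_parity (l1 ++ map g (tleaves t) ++ l2) *+ C (ttree_map (pred1 k) t) : F^o) f = 0.
Proof.
move=> tabC [/allP fTT f0] Ug N0.
have Ig : injective g.
  move: Ug; rewrite cat_uniq => /and3P[_ _]; rewrite cat_uniq => /and3P[/injectiveP ? _ _].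
  by [].
pose th (u : ptree nat) : F^o := (-1) ^+ inv_parity (l1 ++ pleaves u ++ l2) *
  (tab (ptree_map (pred1 (g k)) u))%:~R.
have := congr1 (lext th) (ker_expansion_planar g f0).
rewrite linear0 (lext_comp _ _ (lext_is_linear th)) => E.
apply: (mulfI N0); rewrite mulr0 -{}E !lextE mulr_sumr; apply: eq_big_seq => t Ht.
suff K : lext th (\sum_(q <- signed_expansion (ttree_map g t)) << q.2 >>) = N%:R *
    ((-1) ^+ inv_parity (l1 ++ map g (tleaves t) ++ l2) *+ C (ttree_map (pred1 k) t)) :> F.
  exact: etrans (mulrCA _ _ _) (congr1 (fun z : F => f@_t * z) (esym K)).
have pt := fTT _ Ht.
have U : uniq (l1 ++ tleaves (ttree_map g t) ++ l2).
  rewrite tleaves_map (perm_uniq (_ : perm_eq _ (l1 ++ map g (enum 'I_n) ++ l2))) //.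
  by rewrite perm_cat2l perm_cat2r perm_map.
have mt : ttree_map (pred1 k) t = ttree_map (pred1 (g k)) (ttree_map g t).
  by rewrite ttree_map_comp; apply: eq_ttree_map => j /=; rewrite inj_eq.
have := tabC (ttree_map (pred1 k) t).
rewrite !tleaves_map size_map count_map (perm_size pt) size_enum_ord.
have -> : count (preim (pred1 k) id) (tleaves t) = 1%N.
  rewrite (seq.permP pt) (eq_count (a2 := pred1 k)) //.
  by rewrite count_uniq_mem ?enum_uniq // mem_enum.
move/(_ erefl erefl)/(congr1 (fun z : int => z%:~R : F)).
rewrite {1}mt signed_expansion_map big_map rmorph_sum /= => E.
rewrite linear_sum /=; apply/esym.
transitivity ((-1) ^+ inv_parity (l1 ++ map g (tleaves t) ++ l2) *
    (C (ttree_map (pred1 k) t) * N)%:R : F).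
  by case: (C _); rewrite ?mul1n ?mul0n ?mulr1n ?mulr0 ?mulr0n // mulrC.
rewrite -[(_ * N)%:R]/((C (ttree_map (pred1 k) t) * N)%:Z%:~R) -E mulr_sumr.
apply: eq_big_seq => q Hq; rewrite lextU /th.
have [_ ->] := parity_expansion Hq; last by [].
by rewrite signr_addb tleaves_map rmorphM rmorph_sign /= mulrA [X in X * _]mulrC.
Qed.
End Functional.

(** * Functionals in degree 5 *)

Lemma size_tleaves1 (Y : Type) (t : ttree Y) : size (tleaves t) = 1%N ->
  exists x, t = TLeaf x.
Proof.
case: t => [x|i t u v] /=; first by exists x.
have := odd_size_tleaves t; have := odd_size_tleaves u; have := odd_size_tleaves v.
by rewrite !size_cat; lia.
Qed.

Lemma size_tleaves3 (Y : Type) (t : ttree Y) : size (tleaves t) = 3 ->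
  exists i a b c, t = TNode i (TLeaf a) (TLeaf b) (TLeaf c).
Proof.
case: t => [x|i t u v] //=; rewrite !size_cat.
have := odd_size_tleaves t; have := odd_size_tleaves u; have := odd_size_tleaves v.
move=> ov ou ot E.
have [] : (size (tleaves t) = 1 /\ size (tleaves u) = 1 /\ size (tleaves v) = 1)%N by lia.
by move=> /size_tleaves1[a ->] [/size_tleaves1[b ->] /size_tleaves1[c ->]]; exists i, a, b, c.
Qed.

(** The three factors have odd sizes adding up to 5: one is a triple, the others are leaves. *)
Lemma ttree5_ind (Y : Type) (P : ttree Y -> Prop) :
  (forall i j a b c d e, P (TNode i (TNode j (TLeaf a) (TLeaf b) (TLeaf c)) (TLeaf d) (TLeaf e))) ->
  (forall i j a b c d e, P (TNode i (TLeaf a) (TNode j (TLeaf b) (TLeaf c) (TLeaf d)) (TLeaf e))) ->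
  (forall i j a b c d e, P (TNode i (TLeaf a) (TLeaf b) (TNode j (TLeaf c) (TLeaf d) (TLeaf e)))) ->
  forall t, size (tleaves t) = 5 -> P t.
Proof.
move=> P1 P2 P3 [//|i t u v] /=; rewrite !size_cat.
have := odd_size_tleaves t; have := odd_size_tleaves u; have := odd_size_tleaves v.
move=> ov ou ot E.
have : [\/ [/\ size (tleaves t) = 3, size (tleaves u) = 1 & size (tleaves v) = 1],
          [/\ size (tleaves t) = 1, size (tleaves u) = 3 & size (tleaves v) = 1]
        | [/\ size (tleaves t) = 1, size (tleaves u) = 1 & size (tleaves v) = 3]]%N.
  have [e1|e1] : (size (tleaves t) = 3 \/ size (tleaves t) = 1)%N by lia.
    by constructor 1; split; lia.
  have [e2|e2] : (size (tleaves u) = 3 \/ size (tleaves u) = 1)%N by lia.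
    by constructor 2; split; lia.
  by constructor 3; split; lia.
case=> -[].
- by move=> /size_tleaves3[j [a [b [c ->]]]] /size_tleaves1[d ->] /size_tleaves1[e ->].
- by move=> /size_tleaves1[d ->] /size_tleaves3[j [a [b [c ->]]]] /size_tleaves1[e ->].
- by move=> /size_tleaves1[d ->] /size_tleaves1[e ->] /size_tleaves3[j [a [b [c ->]]]].
Qed.

Definition pleaf (b : bool) := PNode PNil b PNil.
Definition comb : ptree bool := PNode PNil false (pleaf false).
Definition cocomb : ptree bool := PNode (pleaf false) false PNil.

Definition lookup (s : seq (ptree bool * int)) (u : ptree bool) : int :=
  foldr (fun p z => if p.1 == u then p.2 else z) 0 s.

Definition chain_last (m : ttree bool) : bool :=
  if m is TNode false (TLeaf false) (TLeaf false)
    (TNode false (TLeaf false) (TLeaf false) (TLeaf true)) then true else false.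
Definition chain_mid (m : ttree bool) : bool :=
  if m is TNode false (TLeaf false) (TLeaf false)
    (TNode false (TLeaf x) (TLeaf y) (TLeaf false)) then x (+) y else false.
Definition chain7 (m : ttree bool) : bool :=
  if m is TNode false (TLeaf false) (TLeaf false) m' then chain_mid m' else false.

(* In both tables the coefficients are 8 times those of a functional on the   *)
(* normal forms of degree 5 that pulls back, under the signed expansion, to   *)
(* the indicator function of chain_last, respectively chain_mid; they were    *)
(* found by solving a linear system.                                          *)
Definition last_table : seq (ptree bool * int) :=
  [:: (PNode comb true comb, 2); (PNode cocomb true comb, -1);
      (PNode comb true cocomb, -1)].

Definition mid_table : seq (ptree bool * int) :=
  [:: (PNode (PNode (pleaf false) false (PNode PNil true (pleaf false))) false PNil, -4);
      (PNode PNil false (PNode (PNode PNil false (PNode (pleaf false) true PNil)) false PNil), 2);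
      (PNode (PNode (PNode PNil false (PNode (pleaf true) false PNil)) false PNil) false PNil, -2);
      (PNode (PNode (PNode PNil false (PNode (pleaf false) true PNil)) false PNil) false PNil, -2);
      (PNode (PNode PNil false (PNode PNil false (PNode (pleaf true) false PNil))) false PNil, -2);
      (PNode PNil false (PNode (PNode (pleaf false) true (pleaf false)) false PNil), 4);
      (PNode PNil false (PNode (PNode PNil false (PNode PNil true PNil)) false (pleaf false)), 4)].

(** Big operators are locked; the fold can be evaluated by [vm_compute]. *)
Lemma sum_foldr (V : nmodType) (I : Type) (r : seq I) (h : I -> V) :
  \sum_(i <- r) h i = foldr (fun i => +%R (h i)) 0 r.
Proof. by rewrite unlock. Qed.

Definition table_sum (s : seq (ptree bool * int)) (m : ttree bool) : int :=
  foldr (fun q : bool * ptree bool => +%R ((-1) ^+ q.1 * lookup s q.2)) 0 (signed_expansion m).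

(** A check of 60 cases: three shapes, four choices of products, five places of the mark. *)
Lemma last_tableP (m : ttree bool) : size (tleaves m) = 5 -> count id (tleaves m) = 1%N ->
  \sum_(q <- signed_expansion m) (-1) ^+ q.1 * lookup last_table q.2 = (chain_last m * 8)%:Z.
Proof.
rewrite sum_foldr -/(table_sum _ _) => sm c1; apply/eqP; move: m sm c1; apply: ttree5_ind;
  by do 7 case=> //; move=> _; vm_compute.
Qed.

Lemma mid_tableP (m : ttree bool) : size (tleaves m) = 5 -> count id (tleaves m) = 1%N ->
  \sum_(q <- signed_expansion m) (-1) ^+ q.1 * lookup mid_table q.2 = (chain_mid m * 8)%:Z.
Proof.
rewrite sum_foldr -/(table_sum _ _) => sm c1; apply/eqP; move: m sm c1; apply: ttree5_ind;
  by do 7 case=> //; move=> _; vm_compute.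
Qed.

(** * Liftings *)

Fixpoint ttree_graft (Y Z : Type) (a : Y -> ttree Z) (t : ttree Y) : ttree Z :=
  match t with
  | TLeaf x => a x
  | TNode i t u v => TNode i (ttree_graft a t) (ttree_graft a u) (ttree_graft a v)
  end.

Lemma ttree_map_graft (X Y Z : Type) (b : Y -> Z) (a : X -> ttree Y) t :
  ttree_map b (ttree_graft a t) = ttree_graft (fun x => ttree_map b (a x)) t.
Proof. by elim: t => //= i t -> u -> v ->. Qed.

Lemma ttree_graft_leaf (Y Z : Type) (a : Y -> Z) t :
  ttree_graft (fun x => TLeaf (a x)) t = ttree_map a t.
Proof. by elim: t => //= i t -> u -> v ->. Qed.

Lemma eq_ttree_graft (Y Z : Type) (a b : Y -> ttree Z) :
  a =1 b -> ttree_graft a =1 ttree_graft b.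
Proof. by move=> ab; elim=> [x|i t IHt u IHu v IHv] /=; rewrite ?ab ?IHt ?IHu ?IHv. Qed.

Lemma chain_last_shape (Y : Type) (p : pred Y) (t : ttree Y) :
  chain_last (ttree_map p t) -> exists a b c d e,
  t = TNode false (TLeaf a) (TLeaf b) (TNode false (TLeaf c) (TLeaf d) (TLeaf e)) /\
  [/\ ~~ p a, ~~ p b, ~~ p c, ~~ p d & p e].
Proof.
case: t => [//|[//|] [a|[] ? ? ?] //= t2 t3] /=; case pa: (p a) => //.
case: t2 => [b|[] ? ? ?] //=; case pb: (p b) => //.
case: t3 => [//|[//|] [c|[] ? ? ?] //= t2 t3]; case pc: (p c) => //.
case: t2 => [d|[] ? ? ?] //=; case pd: (p d) => //.
case: t3 => [e|[] ? ? ?] //=; case pe: (p e) => // _.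
by exists a, b, c, d, e; rewrite pa pb pc pd pe.
Qed.

Lemma chain7_leaf3 i (t u : ttree bool) x : chain7 (TNode i t u (TLeaf x)) = false.
Proof. by case: i t u => [] [[]|[] ? ? ?] // [[]|[] ? ? ?]. Qed.

(** A chain contains a single triple of leaves, its innermost one, so the grafted triple must be
    that one: [k] ends a chain of degree 5 and the mark is in the graft. *)
Lemma chain7_graft (Y : eqType) (m : Y -> bool) (k : Y) (i mk my mz : bool) (t : ttree Y) :
  ([&& ~~ i, mk (+) my & ~~ mz] -> forall j, j != k -> m j = false) ->
  size (tleaves t) = 5 ->
  chain7 (ttree_graft (fun j => if j == k then TNode i (TLeaf mk) (TLeaf my) (TLeaf mz)
     else TLeaf (m j)) t) =
  chain_last (ttree_map (pred1 k) t) && [&& ~~ i, mk (+) my & ~~ mz].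
Proof.
move=> mN; move: t; apply: ttree5_ind => i0 j0 a b c d e /=.
- by case: i0.
- by case: i0 => //; case: (a == k) => //=; case: (m a) => //; case: (b == k); case: (m b).
- case: i0 => //.
  case: (altP (a =P k)) => [_ //|ak] /=.
  case: (altP (b =P k)) => [_ //|bk] /=; first by case: (m a).
  case: j0 => /=; first by case: (m a) => //; case: (m b).
  case: (altP (c =P k)) => [_ //|ck] /=; first by case: (m a) => //; case: (m b).
  case: (altP (d =P k)) => [_ //|dk] /=; first by case: (m a) => //; case: (m b) => //; case: (m c).
  case: (altP (e =P k)) => [_ //|ek] /=; last first.
    by case: (m a) => //; case: (m b) => //; case: (m c) => //; case: (m d) => //; case: (m e).
  case C: [&& _, _ & _].
    by rewrite !(mN C) //; case: i mk my mz C {mN} => [] [] [] [].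
  by move: C; case: (m a) => //; case: (m b) => //; case: (m c) => //; case: (m d) => //;
    case: i mk my mz {mN} => [] [] [] [].
Qed.

(** * The functional in degree 7 and its vanishing on liftings *)

Section Substitution.
Variable F : fieldType.

Lemma tsubstE (X Y : choiceType) (a : X -> {malg F[ttree Y]}) (b : X -> ttree Y) f :
  (forall x, a x = << b x >>) -> tsubst a f = lext (fun t => << ttree_graft b t >>) f.
Proof.
move=> ab; apply: eq_lext; elim=> [x|i t IHt u IHu v IHv] /=; first exact: ab.
by rewrite IHt IHu IHv tmulUUU.
Qed.

Lemma tperm_actE n (s : 'S_n) f :
  tperm_act s f = lext (fun t => << ttree_map s t >>) f :> {malg F[ttree 'I_n]}.
Proof.
rewrite /tperm_act (@tsubstE _ _ _ (fun j => TLeaf (s j))) //.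
by apply: eq_lext => t; rewrite ttree_graft_leaf.
Qed.

Lemma tperm_act_linear n (s : 'S_n) : linear (@tperm_act F n s).
Proof. by move=> a f g; rewrite !tperm_actE linearP. Qed.

Lemma tperm_actM n (s1 s2 : 'S_n) (f : {malg F[ttree 'I_n]}) :
  tperm_act s1 (tperm_act s2 f) = tperm_act (s2 * s1)%g f.
Proof.
rewrite [tperm_act s2 f]tperm_actE (lext_comp _ _ (tperm_act_linear s1)) tperm_actE.
apply: eq_lext => t /=; rewrite tperm_actE lextU ttree_map_comp; congr << _ >>.
by apply: eq_ttree_map => j; rewrite /= permM.
Qed.

Lemma tperm_act1 n (f : {malg F[ttree 'I_n]}) : tperm_act 1%g f = f.
Proof.
rewrite tperm_actE; move: f; apply: linear_lext_ext => // [a f g|t].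
  by rewrite linearP.
rewrite lextU; congr << _ >>.
by elim: t => [x|i t IHt u IHu v IHv] /=; rewrite ?perm1 ?IHt ?IHu ?IHv.
Qed.

Lemma tmul_lext (X : choiceType) (K : choiceType) i (y z : ttree X) (h : K -> ttree X) f :
  [/\ tmul i (lext (fun k => << h k >>) f) << y >> << z >> =
        lext (fun k => << TNode i (h k) y z >>) f,
      tmul i << y >> (lext (fun k => << h k >>) f) << z >> =
        lext (fun k => << TNode i y (h k) z >>) f
    & tmul i << y >> << z >> (lext (fun k => << h k >>) f) =
        lext (fun k => << TNode i y z (h k) >>) f :> {malg F[ttree X]}].
Proof.
rewrite tmul.unlock; split; rewrite ?lextU; rewrite (lext_comp _ _ (lext_is_linear _));
  by apply: eq_lext => k /=; rewrite !lextU.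
Qed.

Definition sign_functional : {malg F[ttree 'I_7]} -> F^o :=
  lext (fun t : ttree 'I_7 =>
   (-1) ^+ inv_parity (map val (tleaves t)) *+ chain7 (ttree_map (pred1 ord_max) t) : F^o).

Lemma sign_functional_act (s : 'S_7) (K : choiceType) (h : K -> ttree 'I_7) (f : {malg F[K]}) :
  sign_functional (tperm_act s (lext (fun k => << h k >>) f)) =
  lext (fun k => (-1) ^+ inv_parity (map (val \o s) (tleaves (h k))) *+
    chain7 (ttree_map (fun j => s j == ord_max) (h k)) : F^o) f.
Proof.
rewrite (lext_comp _ _ (tperm_act_linear s)) /sign_functional (lext_comp _ _ (lext_is_linear _)).
apply: eq_lext => k /=; rewrite tperm_actE !lextU tleaves_map -map_comp.
by rewrite ttree_map_comp.
Qed.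

Lemma chain_mid_false (Y : Type) (t : ttree Y) : chain_mid (ttree_map (fun=> false) t) = false.
Proof.
by case: t => // -[] // [] // ? [] // ? [] // [] // [] // ? [] // ? [] // ?.
Qed.

Lemma uniq_lifted_vars n (s : 'S_(n + 2)) :
  uniq ([seq val (s (lshift 2 j)) | j <- enum 'I_n] ++
    [:: val (s (rshift n ord0)); val (s (rshift n ord_max))]).
Proof.
pose r : seq 'I_(n + 2) := map (lshift 2) (enum 'I_n) ++ map (@rshift n 2) [:: ord0; ord_max].
rewrite (_ : _ ++ _ = map (val \o s) r); last first.
  by rewrite /r map_cat; congr (_ ++ _); rewrite -[RHS]map_comp.
rewrite map_inj_uniq; last by move=> a b /= /val_inj/perm_inj.
rewrite cat_uniq !map_inj_uniq //; try exact: lshift_inj; try exact: rshift_inj.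
rewrite andbT -enumT enum_uniq /=.
by rewrite !orbF negb_or; apply/andP; split; apply/mapP => -[j' _ /eqP]; rewrite eq_rlshift.
Qed.

Hypothesis charF : [pchar F] =i pred0.

Lemma nat8_neq0 : 8%:R != 0 :> F.
Proof. by rewrite ((pcharf0P F).1 charF). Qed.

(** With [f] as last factor, the chain continues inside [f], where its two inner triples form the
    pattern of [chain_mid]; the word starts with the two new variables. *)
Lemma sign_functional_product (f : {malg F[ttree 'I_5]}) (s : 'S_(5 + 2)) i :
  ker_expansion f ->
  let y := TLeaf (rshift 5 (ord0 : 'I_2)) in let z := TLeaf (rshift 5 (ord_max : 'I_2)) in
  lext (fun t =>
    (-1) ^+ inv_parity (map (val \o s) (tleaves (TNode i y z (ttree_map (lshift 2) t)))) *+
    chain7 (ttree_map (fun j => s j == ord_max) (TNode i y z (ttree_map (lshift 2) t)))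
    : F^o) f = 0.
Proof.
move=> fK y z; pose g (j : 'I_5) := val (s (lshift 2 j)).
(* If no variable of [f] is sent to the marked one, the inner part of the chain carries no mark and
   all terms vanish. *)
have [/existsP[k /eqP sk]|/existsPn sN] := boolP [exists k, s (lshift 2 k) == ord_max]; last first.
  apply: lext0 => t _; rewrite /= ttree_map_comp.
  rewrite (eq_ttree_map (b := fun=> false)); last by move=> j /=; apply/negbTE/sN.
  by case: i (s _ == _) (s _ == _) => [] [] [] //; rewrite chain_mid_false mulr0n.
pose l1 := [:: val (s (rshift 5 ord0)); val (s (rshift 5 ord_max))].
have U : uniq (l1 ++ map g (enum 'I_5) ++ [::]).
  by rewrite cats0 uniq_catC uniq_lifted_vars.
have := ker_expansion_functional k (l1 := l1) (l2 := [::]) mid_tableP fK U nat8_neq0.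
have ne w : s (rshift 5 w) == ord_max = false.
  by rewrite -sk (inj_eq perm_inj) eq_rlshift.
case: i; first by move=> _; apply: lext0 => t _; rewrite /= mulr0n.
move=> <-; apply: eq_lext => t /=; rewrite !ne cats0 tleaves_map -map_comp ttree_map_comp.
rewrite (eq_ttree_map (b := pred1 k)) // => j /=.
by rewrite -sk (inj_eq perm_inj) (inj_eq (@lshift_inj _ _)).
Qed.

Lemma sign_functional_subst (f : {malg F[ttree 'I_5]}) (s : 'S_(5 + 2)) i k :
  ker_expansion f ->
  let y := TLeaf (rshift 5 (ord0 : 'I_2)) in let z := TLeaf (rshift 5 (ord_max : 'I_2)) in
  let a j := if j == k then TNode i (TLeaf (lshift 2 k)) y z else TLeaf (lshift 2 j) in
  lext (fun t => (-1) ^+ inv_parity (map (val \o s) (tleaves (ttree_graft a t))) *+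
    chain7 (ttree_map (fun j => s j == ord_max) (ttree_graft a t)) : F^o) f = 0.
Proof.
move=> fK y z a; pose g (j : 'I_5) := val (s (lshift 2 j)).
pose l2 := [:: val (s (rshift 5 ord0)); val (s (rshift 5 ord_max))].
pose mx x := s x == ord_max.
pose c := [&& ~~ i, mx (lshift 2 k) (+) mx (rshift 5 ord0) & ~~ mx (rshift 5 ord_max)].
have cN : c -> forall j, j != k -> mx (lshift 2 j) = false.
  case/and3P=> _ H _ j jk; apply/negbTE/negP => /eqP sj.
  move: H; rewrite /mx -sj !(inj_eq perm_inj) (inj_eq (@lshift_inj _ _)).
  by rewrite eq_sym (negbTE jk) eq_rlshift.
(* In the surviving monomials x_k comes last, so after the substitution the two new variables end
   the word. *)
have E t : t \in msupp f ->
    (-1) ^+ inv_parity (map (val \o s) (tleaves (ttree_graft a t))) *+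
    chain7 (ttree_map (fun j => s j == ord_max) (ttree_graft a t)) =
    (-1) ^+ inv_parity ([::] ++ map g (tleaves t) ++ l2) *+
    chain_last (ttree_map (pred1 k) t) *+ c :> F^o.
  move=> Ht; rewrite ttree_map_graft.
  rewrite (eq_ttree_graft (b := fun j => if j == k
    then TNode i (TLeaf (mx (lshift 2 k))) (TLeaf (mx (rshift 5 ord0)))
           (TLeaf (mx (rshift 5 ord_max)))
    else TLeaf (mx (lshift 2 j)))); last first.
    by move=> j; rewrite /a; case: ifP.
  rewrite (chain7_graft (m := fun j => mx (lshift 2 j)) cN); last first.
    by case: fK => /allP/(_ _ Ht)/perm_size -> _; rewrite size_enum_ord.
  case: (boolP (chain_last _)) => [H|_]; last by rewrite !mulr0n mul0rn.
  rewrite /= mulr1n -/c; congr ((-1) ^+ inv_parity _ *+ _).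
  have [a1 [a2 [a3 [a4 [a5 [-> [n1 n2 n3 n4 /eqP e5]]]]]]] := chain_last_shape H.
  move: n1 n2 n3 n4 => /= /negbTE n1 /negbTE n2 /negbTE n3 /negbTE n4.
  by rewrite /a n1 n2 n3 n4 e5 eqxx.
rewrite (eq_lext_supp E).
have U : uniq ([::] ++ map g (enum 'I_5) ++ l2) by exact: uniq_lifted_vars.
have := ker_expansion_functional k last_tableP fK U nat8_neq0.
by case: c {cN E} => E; [rewrite -[RHS]E | apply: lext0 => t _]; rewrite ?mulr0n.
Qed.

(** Quantifying over [s] carries the induction through the group action. In the products where [f]
    is not last, the last factor is a leaf and no chain arises. *)
Lemma sign_functional_lifted (g : {malg F[ttree 'I_(5 + 2)]}) :
  lifted_identities g -> forall s : 'S_7, sign_functional (tperm_act s g) = 0.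
Proof.
elim=> {g} [g [f fK]|s|a f g _ IHf _ IHg s|s1 f _ IHf s].
- pose y := TLeaf (rshift 5 (ord0 : 'I_2)); pose z := TLeaf (rshift 5 (ord_max : 'I_2)).
  have fE : tsubst (fun j => tvar F (lshift 2 j)) f =
      lext (fun t => << ttree_map (lshift 2) t >>) f.
    rewrite (@tsubstE _ _ _ (fun j => TLeaf (lshift 2 j))) //.
    by apply: eq_lext => t; rewrite ttree_graft_leaf.
  rewrite /liftings mem_cat => /orP[/allpairsP[[i k] /= [_ _ ->]] s|Hg s].
    pose a j := if j == k then TNode i (TLeaf (lshift 2 k)) y z else TLeaf (lshift 2 j).
    rewrite (@tsubstE _ _ _ a) ?(sign_functional_act s) ?sign_functional_subst //.
    by move=> j; rewrite /a; case: ifP => _ //; rewrite /tvar tmulUUU.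
  case/flattenP: Hg => r /mapP[i _ ->]; rewrite fE !inE.
  have [E1 E2 E3] := tmul_lext i y z (ttree_map (lshift 2)) f.
  case/or3P=> /eqP->.
  + rewrite E1 (sign_functional_act s); apply: lext0 => t _.
    by rewrite (_ : chain7 _ = false) ?mulr0n //; exact: chain7_leaf3.
  + rewrite E2 (sign_functional_act s); apply: lext0 => t _.
    by rewrite (_ : chain7 _ = false) ?mulr0n //; exact: chain7_leaf3.
  + rewrite E3 (sign_functional_act s); exact: sign_functional_product.
- by rewrite tperm_actE /sign_functional !linear0.
- by rewrite tperm_act_linear /sign_functional linearP /= -/sign_functional IHf IHg scaler0 addr0.
- by rewrite tperm_actM.
Qed.

End Substitution.

(** * The new identity *)

(* The monomials of the new identity and their coefficients; true marks the   *)
(* variable outside the alternation. As every variable counts as odd, moving  *)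
(* the marked one past another one costs a sign.                              *)
Definition identity_table : seq (int * ttree bool) :=
  let b := TLeaf true in let o := TLeaf false in
  let t := TNode false in let u := TNode true in
  [:: (-1, t (t o b (t o o o)) o o);
      (-1, t (t o b (u o o o)) o o);
      (-1, t (t o b o) (t o o o) o);
      (2, t (t o o (t o b o)) o o);
      (-1, t (t o o (t o o o)) b o);
      (2, t (t o o (u o o b)) o o);
      (-1, t (t o o (u o o o)) b o);
      (-1, t (t o o o) (t o b o) o);
      (2, t (t o o o) (t o o b) o);
      (2, t (u (t o b o) o o) o o);
      (-1, t (u (t o o o) o b) o o);
      (-1, t (u (t o o o) o o) b o);
      (2, t (u (u o o b) o o) o o);
      (-1, t (u (u o o o) o b) o o);
      (-1, t (u (u o o o) o o) b o);
      (-1, t (u o o b) (t o o o) o);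
      (-1, t (u o o o) (t o b o) o);
      (2, t (u o o o) (t o o b) o);
      (-1, t o (t o b (t o o o)) o);
      (2, t o (t o o (t o b o)) o);
      (-1, t o (t o o (t o o b)) o);
      (1, t o b (t o o (t o o o)));
      (-2, t o o (t o b (t o o o)));
      (1, t o o (t o o (t o b o)))].

Fixpoint label (m : ttree bool) (w : seq 'I_7) : ttree 'I_7 * seq 'I_7 :=
  match m with
  | TLeaf true => (TLeaf ord_max, w)
  | TLeaf false => (TLeaf (head ord_max w), behead w)
  | TNode i m1 m2 m3 =>
      let: (t1, w1) := label m1 w in let: (t2, w2) := label m2 w1 in
      let: (t3, w3) := label m3 w2 in (TNode i t1 t2 t3, w3)
  end.

(* The unmarked leaves are numbered from left to right. *)
Definition labelled (m : ttree bool) : ttree 'I_7 :=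
  (label m [:: @Ordinal 7 0 isT; @Ordinal 7 1 isT; @Ordinal 7 2 isT;
     @Ordinal 7 3 isT; @Ordinal 7 4 isT; @Ordinal 7 5 isT]).1.

Lemma identity_tableP : {in identity_table, forall p,
  [/\ uniq (tleaves (labelled p.2)), size (tleaves (labelled p.2)) = 7
    & ttree_map (pred1 ord_max) (labelled p.2) = p.2]}.
Proof.
move=> p pT; pose chk (p : int * ttree bool) :=
  [&& uniq (tleaves (labelled p.2)), size (tleaves (labelled p.2)) == 7
    & ttree_map (pred1 ord_max) (labelled p.2) == p.2].
have /allP/(_ p pT) : all chk identity_table by vm_compute.
by case/and3P=> ? /eqP ? /eqP.
Qed.

Fixpoint ptree_eqb (u v : ptree bool) : bool :=
  match u, v with
  | PNil, PNil => true
  | PNode l x r, PNode l' x' r' => [&& eqb x x', ptree_eqb l l' & ptree_eqb r r']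
  | _, _ => false
  end.

Lemma ptree_eqb_eq u v : ptree_eqb u v -> u = v.
Proof.
by elim: u v => [|l IHl x r IHr] [|l' x' r'] //= /and3P[/eqP-> /IHl-> /IHr->].
Qed.

Fixpoint collect1 (c : int) (u : ptree bool) (s : seq (int * ptree bool)) :=
  if s is p :: s' then
    if ptree_eqb u p.2 then (if c + p.1 == 0 then s' else (c + p.1, u) :: s')
    else p :: collect1 c u s'
  else [:: (c, u)].

Definition collect (s : seq (int * ptree bool)) :=
  foldr (fun p => collect1 p.1 p.2) [::] s.

Lemma sum_collect (F : fieldType) (V : lmodType F) (H : ptree bool -> V) s :
  \sum_(p <- collect s) p.1%:~R *: H p.2 = \sum_(p <- s) p.1%:~R *: H p.2.
Proof.
elim: s => //= -[c u] s IH; rewrite big_cons -IH /=.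
elim: (collect s) => [|[d v] s' IH'] /=; first by rewrite big_seq1 big_nil addr0.
case: ifP => [/ptree_eqb_eq <-|_]; last by rewrite !big_cons IH' addrCA.
rewrite big_cons addrA -scalerDl -intrD.
by case: ifP => [/eqP->|_]; rewrite ?scale0r ?add0r ?big_cons.
Qed.

(** The parities become signs here because the variables behind the unmarked leaves are
    alternated. *)
Definition marked_terms : seq (int * ptree bool) :=
  flatten [seq [seq (p.1 * (-1) ^+ q.1, q.2)
    | q : bool * ptree bool <- signed_expansion p.2] | p <- identity_table].

Lemma collect_marked_terms : collect marked_terms = [::].
Proof. by vm_compute. Qed.

Lemma ptree_map_relabel (Y : eqType) (K : Type) (m : Y -> K) (s : Y -> Y) (u v : ptree Y) :
  ptree_map m u = ptree_map m v -> map s (pleaves u) = pleaves v -> ptree_map s u = v.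
Proof.
elim: u v => [|l IHl x r IHr] [|l' x' r'] //= [ml _ mr] /eqP; rewrite map_cat /=.
have sl : size (pleaves l) = size (pleaves l').
  by rewrite -(size_map m) -pleaves_map ml pleaves_map size_map.
rewrite eqseq_cat ?size_map // eqseq_cons => /and3P[/eqP el /eqP -> /eqP er].
by rewrite (IHl _ ml el) (IHr _ mr er).
Qed.

Lemma perm_enum_ord n (w : seq 'I_n) : uniq w -> size w = n -> perm_eq w (enum 'I_n).
Proof.
move=> U sw; apply: uniq_perm => //; first exact: enum_uniq.
have wE : {subset w <= enum 'I_n} by move=> z _; rewrite mem_enum.
have sE : (size (enum 'I_n) <= size w)%N by rewrite size_enum_ord sw.
by have [_ E] := uniq_min_size U wE sE.
Qed.

(** Both words list all of 'I_n, so matching them position by position is a permutation; equal marks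
    put [x] at the same position in both. *)
Lemma exists_relabel n (x : 'I_n) (w w' : seq 'I_n) : uniq w -> uniq w' ->
  size w = n -> size w' = n -> map (pred1 x) w = map (pred1 x) w' ->
  exists2 s : 'S_n, s x = x & map s w = w'.
Proof.
move=> Uw Uw' sw sw' E.
have mem_all (v : seq 'I_n) y : uniq v -> size v = n -> y \in v.
  by move=> Uv sv; rewrite (perm_mem (perm_enum_ord Uv sv)) mem_enum.
pose h y := nth x w' (index y w).
have ih : injective h.
  have iw y : (index y w < size w')%N by rewrite sw' -[X in (_ < X)%N]sw index_mem mem_all.
  move=> y z /eqP; rewrite /h nth_uniq //.
  by move=> /eqP /(congr1 (nth x w)); rewrite !nth_index ?mem_all.
exists (perm ih).
  rewrite permE /h.
  have -> : index x w = index x w'.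
    rewrite /index !(eq_find (a2 := preim (pred1 x) id)) // -!find_map.
    by rewrite E.
  by rewrite nth_index ?mem_all.
apply: (@eq_from_nth _ x); rewrite size_map ?sw ?sw' // => i Hi.
rewrite (nth_map x) ?sw // permE /h index_uniq ?sw //.
Qed.

(** * The identity as an alternating sum *)

Section Identity.
Variable F : fieldType.

Definition fixes_last (s : 'S_7) := s ord_max == ord_max.

Definition word_sign (s : 'S_7) (w : seq 'I_7) : F := (-1) ^+ inv_parity (map (val \o s) w).

Definition new_identity : {malg F[ttree 'I_7]} :=
  \sum_(s : 'S_7 | fixes_last s) \sum_(p <- identity_table)
    (p.1%:~R * word_sign s (tleaves (labelled p.2))) *: << ttree_map s (labelled p.2) >>.

Lemma new_identity_TT : new_identity \in @TT F 7.
Proof.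
have TT0 : 0 \in @TT F 7 by rewrite unfold_in /TT msupp0.
have TTD f g : f \in @TT F 7 -> g \in @TT F 7 -> f + g \in @TT F 7.
  move=> /allP Hf /allP Hg; apply/allP => t /(fsubsetP (msuppD_le _ _)).
  by rewrite in_fsetU => /orP[/Hf|/Hg].
apply: (big_ind (fun f => f \in @TT F 7)) => // s _.
rewrite big_seq; apply: (big_ind (fun f => f \in @TT F 7)) => // p /identity_tableP[U sz _].
apply/allP => t /(fsubsetP (msuppZ_le _ _)); rewrite msuppU oner_eq0 in_fset1 => /eqP ->.
have U' : uniq (tleaves (ttree_map s (labelled p.2))).
  by rewrite tleaves_map map_inj_uniq //; exact: perm_inj.
by apply: perm_enum_ord => //; rewrite tleaves_map size_map sz.
Qed.

Definition alternating_eval (u : ptree 'I_7) : DD F 'I_7 :=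
  \sum_(s : 'S_7 | fixes_last s) word_sign s (pleaves u) *:
    peval (@dprec F 'I_7) (@dsucc F 'I_7) (dvar F (X:='I_7)) (ptree_map s u).

(** A relabelling that fixes the marked variable turns [u] into [v], and translation by it permutes
    the summands. *)
Lemma alternating_eval_marks u v :
  uniq (pleaves u) -> uniq (pleaves v) -> size (pleaves u) = 7 -> size (pleaves v) = 7 ->
  ptree_map (pred1 ord_max) u = ptree_map (pred1 ord_max) v ->
  alternating_eval u = alternating_eval v.
Proof.
move=> Uu Uv su sv E.
have [|s0 s0x s0w] := exists_relabel Uu Uv su sv (x := ord_max).
  by rewrite -!pleaves_map E.
have <- : ptree_map s0 u = v by apply: ptree_map_relabel E s0w.
rewrite /alternating_eval [LHS](reindex_inj (mulgI s0)).
apply: eq_big => [s|s _]; first by rewrite /fixes_last permM s0x.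
have -> : word_sign (s0 * s)%g (pleaves u) = word_sign s (pleaves (ptree_map s0 u)).
  rewrite /word_sign pleaves_map -map_comp; congr ((-1) ^+ inv_parity _).
  by apply: eq_map => j; rewrite /= permM.
have -> // : ptree_map (s0 * s)%g u = ptree_map s (ptree_map s0 u).
by elim: (u) => //= l -> x r ->; rewrite permM.
Qed.

Lemma teval_tree_map (X Y : choiceType) (A : lmodType F) (op : bool -> A -> A -> A -> A)
    (a : Y -> A) (b : X -> Y) t : teval_tree op a (ttree_map b t) = teval_tree op (a \o b) t.
Proof. by elim: t => //= i t -> u -> v ->. Qed.

Lemma expansion_new_identity : expansion new_identity = 0.
Proof.
pose L := [seq (p.1 * (-1) ^+ q.1, q.2) | p : int * ttree bool <- identity_table,
   q : bool * ptree 'I_7 <- signed_expansion (labelled p.2)].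
have EL : expansion new_identity = \sum_(c <- L) c.1%:~R *: alternating_eval c.2.
  rewrite /expansion /teval linear_sum /=.
  under eq_bigr do rewrite linear_sum /=.
  rewrite exchange_big big_allpairs_dep /=; apply: eq_big_seq => p /identity_tableP[U sz _].
  rewrite /alternating_eval.
  under [RHS]eq_bigr do rewrite scaler_sumr.
  rewrite [RHS]exchange_big /=; apply: eq_bigr => s _.
  rewrite linearZ /= lextU teval_tree_map (peval_expansion (DD_is_dendriform F 'I_7)).
  rewrite signed_expansion_map big_map scaler_sumr; apply: eq_big_seq => q Hq /=.
  rewrite scalerA; apply: (congr1 (fun c : F => c *: _)).
  rewrite rmorphM rmorph_sign -mulrA; apply: (congr1 ( *%R _)).
  (* The permuted words of the monomial and of its normal form differ in sign by the Boolean
     [q.1]. *)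
  have := parity_expansion (t := ttree_map (val \o s) (labelled p.2))
    (x := (q.1, ptree_map (val \o s) q.2)).
  rewrite signed_expansion_map => /(_ (map_f _ Hq)) [_ /(_ [::] [::])] /=.
  rewrite !cats0 tleaves_map pleaves_map => I.
  rewrite /word_sign I ?signr_addb ?signrMK //.
  by rewrite map_inj_uniq // => a b /val_inj/perm_inj.
have good c : c \in L -> uniq (pleaves c.2) /\ size (pleaves c.2) = 7.
  case/allpairsPdep=> p [q [/identity_tableP[U sz _] Hq ->]] /=.
  have := parity_expansion (t := ttree_map val (labelled p.2)) (x := (q.1, ptree_map val q.2)).
  rewrite signed_expansion_map => /(_ (map_f _ Hq)) [/= pq _].
  rewrite -(map_inj_uniq val_inj) -(size_map val) -pleaves_map.
  by rewrite (perm_uniq pq) (perm_size pq) tleaves_map (map_inj_uniq val_inj) size_map.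
(* Alternating values as a function of the marked shape, through the first representative in [L];
   shapes that do not occur get 0. Like shapes can now be collected. *)
pose H v := if [seq c <- L | ptree_map (pred1 ord_max) c.2 == v] is c :: _
  then alternating_eval c.2 else 0.
have EH c : c \in L -> alternating_eval c.2 = H (ptree_map (pred1 ord_max) c.2).
  move=> Lc; rewrite /H.
  have : c \in [seq d <- L | ptree_map (pred1 ord_max) d.2 == ptree_map (pred1 ord_max) c.2].
    by rewrite mem_filter eqxx.
  case E : [seq d <- L | _] => [//|d s] _.
  have : d \in [seq d <- L | ptree_map (pred1 ord_max) d.2 == ptree_map (pred1 ord_max) c.2].
    by rewrite E mem_head.
  rewrite mem_filter => /andP[/eqP dc Ld].
  have [Uc sc] := good _ Lc; have [Ud sd] := good _ Ld.
  by apply: alternating_eval_marks.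
rewrite EL; under eq_big_seq => c Lc do rewrite EH //.
transitivity (\sum_(c <- marked_terms) c.1%:~R *: H c.2); last first.
  by rewrite -sum_collect collect_marked_terms big_nil.
rewrite big_allpairs_dep big_flatten big_map; apply: eq_big_seq => p /identity_tableP[_ _ mp].
by rewrite -{2}mp signed_expansion_map -map_comp !big_map.
Qed.

Hypothesis charF : [pchar F] =i pred0.

Lemma sign_functional_new_identity : sign_functional new_identity != 0.
Proof.
rewrite /sign_functional /new_identity linear_sum /=.
(* Each permutation contributes 1, as the sign in the identity cancels the one in the functional;
   the value is the number of permutations. *)
rewrite (eq_bigr (fun=> 1)).
  rewrite sumr_const ((pcharf0P F).1 charF) -lt0n; apply/card_gt0P; exists 1%g.
  by rewrite unfold_in /fixes_last perm1.
move=> s /eqP sx; rewrite linear_sum /=.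
transitivity ((\sum_(p <- identity_table) p.1 *+ chain7 p.2)%:~R : F); last first.
  (* Only the last entry of the table satisfies [chain7], with coefficient 1. *)
  by rewrite sum_foldr (_ : foldr _ _ _ = 1) //; vm_compute.
rewrite rmorph_sum; apply: eq_big_seq => p /identity_tableP[_ _ mp].
rewrite linearZ /= lextU ttree_map_comp (eq_ttree_map (b := pred1 ord_max)); last first.
  by move=> j /=; rewrite -{1}sx (inj_eq perm_inj).
rewrite mp tleaves_map -map_comp rmorphMn /=; case: (chain7 _); rewrite ?mulr0n ?scaler0 //.
rewrite !mulr1n; apply: (etrans (esym (mulrA _ _ _))).
by rewrite /word_sign -signr_addb addbb mulr1.
Qed.
End Identity.

Theorem theorem5p3 (F : fieldType) (charF : [pchar F] =i pred0) :
  exists f : {malg F[ttree 'I_7]},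
    ker_expansion f /\ ~ lifted_identities (n := 5) f.
Proof.
exists (new_identity F); split.
  by split; [exact: new_identity_TT | exact: expansion_new_identity].
move=> /(sign_functional_lifted charF)/(_ 1%g); rewrite tperm_act1.
exact/eqP/sign_functional_new_identity.
Qed.
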